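(* Let $\alpha\in(0,1)\cup(1,2)$ and let $X$ be a random variable with characteristic function $\mathbb{E}e^{itX}=\exp\left(-2\int_0^\infty(1-\cos(tx))\frac{dx}{x^{\alpha+1}}\right)$, $t\in\mathbb{R}$. Then for every $y>0$, $$\mathbb{P}(X\ge y)\ge\frac12\cdot\frac{1}{2+\alpha y^{\alpha}}.$$ Moreover, if $\alpha\in(0,1)$, then for every $y>0$, $$\mathbb{P}(X\ge y)\le\frac{4}{\alpha y^{\alpha}}.$$
   Context: The characteristic function above equals $\exp\left(\int_{\mathbb{R}}(e^{itx}-1)\frac{dx}{|x|^{\alpha+1}}\right)$ (integral in the symmetric principal-value sense), i.e. $X$ is symmetric strictly $\alpha$-stable with Lévy measure $|x|^{-\alpha-1}dx$. *)

(* Defs.v *)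
From HB Require Import structures.
From mathcomp Require Import all_boot all_order all_algebra.
From mathcomp Require Import all_classical all_reals all_analysis.
From mathcomp.real_closed Require Import complex.
Set Implicit Arguments. Unset Strict Implicit. Unset Printing Implicit Defensive.
Import Order.TTheory GRing.Theory Num.Theory.
Local Open Scope classical_set_scope.
Local Open Scope ring_scope.

Definition charfun (d : measure_display) (T : measurableType d) (R : realType)
  (P : probability T R) (X : T -> R) (t : R) : R[i] :=
  (Rintegral P setT (fun w => cos (t * X w)) +i*
   Rintegral P setT (fun w => sin (t * X w)))%C.

Definition stable_exponent (R : realType) (alpha t : R) : R :=
  Rintegral (@lebesgue_measure R) `]0%R, +oo[%classic
    (fun x => (1 - cos (t * x)) * x `^ (- alpha - 1)).

(* Main.v *)
(** Tail bounds for the symmetric stable law, by Fourier analysis.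

    Since [int_0^oo (1 - cos (c t)) / t^2 dt] is proportional to [|c|], the
    trapezoid function [g] (equal to [1] on [[-a, a]], to [0] off [[-b, b]]) is
    the cosine transform of an integrable kernel [k].  By Fubini,
    [E g (X - c)] is [int k(t) cos(t c) phi(t) dt], which depends on [X] only
    through its characteristic function [phi]; hence [X] and [-X] have the same
    tails.

    Lower bound: [phi] is the limit of the [n]-th powers of the characteristic
    functions of the symmetrised Pareto laws with density proportional to
    [|x|^(-alpha-1)] on [|x| >= e_n], so [E g(X)] is the limit of [G_n 0], where
    [G_n] is the [n]-fold average of [g] over such a law.  As in Levy's
    inequality, the property [G (x + s) + G (x - s) <= 1] for [s >= b] is
    preserved by symmetric averaging, and it lets every jump [s >= b] (which has
    probability [p = lambda / n], [lambda = 2 / (alpha b^alpha)]) cost a factor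
    one half:  [G_n <= 1/2 + (1 - p)^n / 2 <= 1/2 + 1 / (2 (1 + lambda))].

    Upper bound: integrating [1 - cos (t X)] over [0 < t <= 2 / y] gives
    [P (|X| >= y) <= y int_0^(2/y) (1 - phi(t)) dt], and
    [1 - phi(t) <= 2 int_0^oo min(t^2 x^2 / 2, 2) x^(-alpha-1) dx]. *)
Require Import Defs.
From HB Require Import structures.
From mathcomp Require Import all_boot all_order all_algebra.
From mathcomp Require Import all_classical all_reals all_analysis.
From mathcomp.real_closed Require Import complex.
From mathcomp Require Import measurable_realfun.
From mathcomp Require Import ring lra.
Set Implicit Arguments. Unset Strict Implicit. Unset Printing Implicit Defensive.
Import Order.TTheory GRing.Theory Num.Theory.
Import numFieldNormedType.Exports.
Local Open Scope classical_set_scope.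
Local Open Scope ring_scope.

(** * Elementary inequalities and power integrals *)

Lemma sin_le_norm {R : realType} (x : R) : `|sin x| <= `|x|.
Proof.
wlog x0 : x / 0 <= x => [hw|].
  have [|/ltW x0] := leP 0 x; first exact: hw.
  by rewrite -normrN -sinN -(normrN x); apply: hw; rewrite oppr_ge0.
have cs : {within `[0, x], continuous (@sin R)}.
  by apply: continuous_subspaceT; exact: continuous_sin.
have [c _] := MVT_segment x0 (fun y _ => is_derive_sin y) cs.
rewrite sin0 !subr0 => ->; rewrite normrM -[leRHS]mul1r.
by rewrite ler_wpM2r// cos_max.
Qed.

Lemma one_sub_cos_ge0 {R : realType} (x : R) : 0 <= 1 - cos x.
Proof. by rewrite subr_ge0 cos_le1. Qed.

Lemma one_sub_cos_le2 {R : realType} (x : R) : 1 - cos x <= 2.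
Proof. by have := cos_geN1 x; lra. Qed.

(** The half-angle identity [1 - cos (2 y) = 2 (sin y)^2] reduces this to [|sin y| <= |y|]. *)
Lemma one_sub_cos_le_sqr {R : realType} (x : R) : 1 - cos x <= x ^+ 2 / 2.
Proof.
have [y ->] : exists y, x = y *+ 2 by exists (x / 2); rewrite mulr2n -splitr.
rewrite cos_mulr2n cos2sin2.
have : sin y ^+ 2 <= y ^+ 2.
  by rewrite -[_ ^+ 2]real_normK ?num_real// -[leRHS]real_normK ?num_real//
    ler_sqr ?nnegrE// sin_le_norm.
have -> : (y *+ 2) ^+ 2 / 2 = 2 * y ^+ 2 by field.
by rewrite !mulr2n; lra.
Qed.

Lemma cvgy_powRN {R : realType} (a : R) : 0 < a ->
  x `^ (- a) @[x --> +oo] --> (0 : R).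
Proof.
move=> a0; apply/cvgrPdist_lt => e e0; near=> x.
(* The threshold is the point where [x ^ (- a)] equals [e]. *)
have x0 : (e^-1) `^ a^-1 < x by near: x; apply: nbhs_pinfty_gt; rewrite num_real.
rewrite sub0r normrN ger0_norm ?powR_ge0// powRN invf_plt ?posrE//; last first.
  by rewrite powR_gt0// (le_lt_trans _ x0)// powR_ge0.
have -> : e^-1 = ((e^-1) `^ a^-1) `^ a.
  by rewrite -powRrM mulVf ?gt_eqF// powRr1// invr_ge0 ltW.
by rewrite gt0_ltr_powR// nnegrE ?powR_ge0// (le_trans _ (ltW x0))// powR_ge0.
Unshelve. all: by end_near. Qed.

Lemma continuous_powR {R : realType} (p x : R) : 0 < x ->
  {for x, continuous (fun y => y `^ p)}.
Proof.
move=> x0; apply: differentiable_continuous; apply/derivable1_diffP.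
by apply: derivable_powR; rewrite in_itv/= x0.
Qed.

Lemma derive1_powR_div {R : realType} (p x : R) : p != 0 -> 0 < x ->
  derive1 (fun y => y `^ p / p) x = x `^ (p - 1).
Proof.
move=> p0 x0; rewrite derive1E deriveMr ?derive1E; last first.
  by apply: derivable_powR; rewrite in_itv/= x0.
by rewrite -derive1E powR_derive1 ?in_itv/= ?x0// mulrA mulVf// mul1r.
Qed.

Lemma derivable_powR_div {R : realType} (p x : R) : 0 < x ->
  derivable (fun y => y `^ p / p) x 1.
Proof.
move=> x0; apply: derivableM => //.
by apply: derivable_powR; rewrite in_itv/= x0.
Qed.

Lemma continuous_powR_div {R : realType} (p x : R) : 0 < x ->
  {for x, continuous (fun y => y `^ p / p)}.
Proof. by move=> x0; apply: cvgM; [exact: continuous_powR|exact: cvg_cst]. Qed.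

Lemma integral_powR_tail {R : realType} (a c : R) : 0 < a -> 0 < c ->
  (\int[@lebesgue_measure R]_(x in `[c, +oo[) (x `^ (- a - 1))%:E
    = (c `^ (- a) / a)%:E)%E.
Proof.
move=> a0 c0.
have aN0 : - a != 0 by rewrite oppr_eq0 gt_eqF.
rewrite (@ge0_continuous_FTC2y _ _ (fun y => y `^ (- a) / - a) c 0)//.
- by rewrite sub0e -EFinN invrN mulrN opprK.
- by move=> x _; exact: powR_ge0.
- apply: derivable_within_continuous => x; rewrite in_itv/= andbT => cx.
  by apply: derivable_powR; rewrite in_itv/= (lt_le_trans c0 cx).
- by rewrite -(mul0r (- a)^-1); apply: cvgM; [exact: cvgy_powRN|exact: cvg_cst].
- by move=> x cx; apply: derivable_powR_div; exact: lt_trans cx.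
- by apply: cvg_at_right_filter; exact: continuous_powR_div.
- move=> x; rewrite in_itv/= andbT => cx.
  by rewrite derive1_powR_div// (lt_trans c0).
Qed.

(** For [b < 1] the integrand blows up at [0], so the fundamental theorem of calculus is applied on
    [[1/(n+1), c]] and both sides are followed as [n] grows. *)
Lemma integral_powR_head {R : realType} (b c : R) : 0 < b -> 0 < c ->
  (\int[@lebesgue_measure R]_(x in `]0%R, c]) (x `^ (b - 1))%:E
    = (c `^ b / b)%:E)%E.
Proof.
move=> b0 c0; rewrite itv_open_bnd_bigcup.
apply: (@cvg_unique _ (@ereal_hausdorff R)
  ((\int[@lebesgue_measure R]_(x in `[(0 + n.+1%:R^-1)%R, c]) (x `^ (b - 1))%:E)%E
    @[n --> \oo])).
  apply: ge0_nondecreasing_set_cvg_integral => //.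
  - move=> m n mn; apply/subsetPset => x /=; rewrite !in_itv/= !add0r => /andP[mx ->].
    by rewrite andbT (le_trans _ mx)// lef_pV2 ?posrE// ler_nat ltnS.
  - move=> n; apply/measurable_EFinP; apply: measurable_funTS.
    exact: measurable_powR.
  - by move=> n x _; rewrite lee_fin powR_ge0.
apply: (@cvg_trans _ ((c `^ b / b - n.+1%:R^-1 `^ b / b)%:E @[n --> \oo])).
  apply: near_eq_cvg; near=> n; rewrite add0r.
  have n0 : 0 < n.+1%:R^-1 :> R by rewrite invr_gt0.
  have nc : n.+1%:R^-1 < c.
    by near: n; exact: near_infty_natSinv_lt (PosNum c0).
  rewrite (@continuous_FTC2 _ _ (fun y => y `^ b / b))// -?EFinD//.
  - apply: derivable_within_continuous => x; rewrite in_itv/= => /andP[cx _].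
    by apply: derivable_powR; rewrite in_itv/= (lt_le_trans n0 cx).
  - split.
    + move=> x; rewrite in_itv/= => /andP[nx _].
      by apply: derivable_powR_div; exact: lt_trans nx.
    + by apply: cvg_at_right_filter; exact: continuous_powR_div.
    + by apply: cvg_at_left_filter; exact: continuous_powR_div.
  - move=> x; rewrite in_itv/= => /andP[nx _].
    by rewrite derive1_powR_div ?gt_eqF// (lt_trans n0).
apply: cvg_EFin; first by near=> n.
rewrite -[X in _ --> X]subr0 -[X in _ --> _ - X](mul0r b^-1).
apply: cvgB; first exact: cvg_cst.
apply: cvgM; last exact: cvg_cst.
(* The points [1/(n+1)] are positive, so they approach [0] along the right-hand filter, on which
   [powR_cvg0] gives the limit. *)
apply: (@cvg_comp _ _ _ (fun n => n.+1%:R^-1 : R) (fun x => x `^ b) _ (0^'+)).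
  move=> A A0; have [N _ hN] := @cvg_harmonic R _ A0.
  by exists N => // n /hN; apply; exact: harmonic_gt0.
exact: powR_cvg0.
Unshelve. all: by end_near. Qed.

(** * The stable exponent *)

Lemma derive1_mull {R : realType} (c : R) : derive1 (fun x : R => c * x) = cst c.
Proof.
by apply/funext => x; rewrite derive1E deriveMl// derive_id mulr1.
Qed.

(** The function may be singular at [0], while the substitution theorem wants continuity up to the
    left endpoint. It is therefore used on [[c/(n+1), +oo[], which corresponds to [[1/(n+1), +oo[]
    after rescaling, and monotone convergence exhausts both half-lines. *)
Lemma ge0_integral_dilation {R : realType} (f : R -> R) (c : R) : 0 < c ->
  (forall x, 0 < x -> 0 <= f x) -> {in `]0, +oo[, continuous f} ->
  (\int[@lebesgue_measure R]_(x in `]0%R, +oo[) (f x)%:E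
   = \int[@lebesgue_measure R]_(x in `]0%R, +oo[) (f (c * x) * c)%:E)%E.
Proof.
move=> c0 f0 cf.
have cfc : {in `]0, +oo[, continuous (fun x => f (c * x) * c)}.
  move=> x; rewrite in_itv/= andbT => x0.
  apply: cvgM; last exact: cvg_cst.
  apply: (@continuous_comp _ _ _ (fun x => c * x) f).
    by apply: cvgM; [exact: cvg_cst|exact: cvg_id].
  by apply: cf; rewrite in_itv/= andbT mulr_gt0.
have mD (g : R -> R) : {in `]0, +oo[, continuous g} ->
    measurable_fun (`]0%R, +oo[ : set R) (EFin \o g).
  move=> cg; apply/measurable_EFinP.
  apply: open_continuous_measurable_fun; first exact: interval_open.
  by move=> x; rewrite inE/=; exact: cg.
have sub (r : R) : 0 < r -> (`[r, +oo[ : set R) `<=` `]0%R, +oo[.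
  by move=> r0 x /=; rewrite !in_itv/= !andbT; exact: lt_le_trans.
have cn0 n : 0 < c * n.+1%:R^-1 by rewrite mulr_gt0// invr_gt0.
have dE : (`]0, +oo[%classic : set R) = \bigcup_n `[c * n.+1%:R^-1, +oo[%classic.
  apply/seteqP; split => x; last by move=> [n _]; exact: sub.
  rewrite /= in_itv/= andbT => x0.
  have : (`]0, +oo[%classic : set R) (c^-1 * x).
    by rewrite /= in_itv/= andbT mulr_gt0// invr_gt0.
  rewrite itvoyEbigcup => -[n _]/=; rewrite in_itv/= andbT add0r => nx.
  by exists n => //=; rewrite in_itv/= andbT -ler_pdivlMl.
rewrite [in LHS]dE [in RHS]itvoyEbigcup.
pose u n := (\int[@lebesgue_measure R]_(x in `[(c * n.+1%:R^-1)%R, +oo[) (f x)%:E)%E.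
pose v n := (\int[@lebesgue_measure R]_(x in `[(0 + n.+1%:R^-1)%R, +oo[)
  (f (c * x) * c)%:E)%E.
have uv : u = v.
  apply/funext => n; rewrite /u /v add0r.
  have n0 : 0 < n.+1%:R^-1 :> R by rewrite invr_gt0.
  rewrite (@increasing_ge0_integration_by_substitutiony _ (fun x => c * x) f).
  - by rewrite derive1_mull.
  - by move=> x y _ _ xy; rewrite ltr_pM2l.
  - by rewrite derive1_mull => x _; exact: cvg_cst.
  - by rewrite derive1_mull; apply: is_cvg_cst.
  - by rewrite derive1_mull; apply: is_cvg_cst.
  - split; first by move=> x _; exact: derivableM.
    by apply: cvg_at_right_filter; apply: cvgM; [exact: cvg_cst|exact: cvg_id].
  - by apply: gt0_cvgMry => //; exact: cvg_id.
  - apply/continuous_within_itvcyP; split.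
      move=> x xn; apply: cf; apply: (sub _ (cn0 n)).
      by move: xn; rewrite /= !in_itv/= !andbT => /ltW.
    apply: cvg_at_right_filter; apply: cf; rewrite in_itv/= andbT//.
  - move=> x; rewrite in_itv/= andbT => nx; apply: f0; exact: lt_trans nx.
apply: (@cvg_unique _ (@ereal_hausdorff R) (u @ \oo)).
  apply: ge0_nondecreasing_set_cvg_integral => //.
  - move=> m n mn; apply/subsetPset => x /=; rewrite !in_itv/= !andbT.
    by apply: le_trans; rewrite (ler_wpM2l (ltW c0))// lef_pV2 ?posrE// ler_nat ltnS.
  - by move=> n; apply: measurable_funS (mD f cf) => //; exact: sub.
  - by move=> n x /(sub _ (cn0 n)); rewrite /= in_itv/= andbT lee_fin; exact: f0.
rewrite uv; apply: ge0_nondecreasing_set_cvg_integral => //.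
- move=> m n mn; apply/subsetPset => x /=; rewrite !in_itv/= !andbT !add0r.
  by apply: le_trans; rewrite lef_pV2 ?posrE// ler_nat ltnS.
- move=> n; apply: measurable_funS (mD _ cfc) => //; apply: sub.
  by rewrite add0r invr_gt0.
- move=> n x; rewrite /= in_itv/= andbT add0r => nx.
  rewrite lee_fin; apply: mulr_ge0; last exact: ltW.
  apply/f0/mulr_gt0 => //; apply: lt_le_trans nx.
  by rewrite invr_gt0.
Qed.

Lemma continuous_cosM {R : realType} (t : R) : continuous (fun x : R => cos (t * x)).
Proof.
move=> x; apply: (@continuous_comp _ _ _ (fun x => t * x)); last exact: continuous_cos.
by apply: cvgM; [exact: cvg_cst|exact: cvg_id].
Qed.

Lemma measurable_cosM {R : realType} (t : R) :
  measurable_fun setT (fun x : R => cos (t * x)).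
Proof. by apply: continuous_measurable_fun; exact: continuous_cosM. Qed.

Lemma measurable_stable_integrand {R : realType} (alpha t : R) :
  measurable_fun setT (fun x : R => (1 - cos (t * x)) * x `^ (- alpha - 1)).
Proof.
apply: measurable_funM; last exact: measurable_powR.
by apply: measurable_funB => //; exact: measurable_cosM.
Qed.

Lemma stable_integrand_ge0 {R : realType} (alpha t x : R) :
  0 <= (1 - cos (t * x)) * x `^ (- alpha - 1).
Proof. by rewrite mulr_ge0 ?powR_ge0// one_sub_cos_ge0. Qed.

(* The integral is split at [2 / t], where the two bounds [(t x)^2 / 2] and [2]
   of [1 - cos (t x)] agree. *)
Lemma integral_stable_le {R : realType} (alpha t : R) : 0 < alpha < 2 -> 0 < t ->
  (\int[@lebesgue_measure R]_(x in `]0%R, +oo[)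
     ((1 - cos (t * x)) * x `^ (- alpha - 1))%:E
   <= ((2 / t) `^ (- alpha) * (4 / (alpha * (2 - alpha))))%:E)%E.
Proof.
move=> /andP[a0 a2] t0; set c := 2 / t.
have c0 : 0 < c by rewrite divr_gt0.
have a20 : 0 < 2 - alpha by rewrite subr_gt0.
have mf (D : set R) : measurable D -> measurable_fun D (fun x : R =>
    ((1 - cos (t * x)) * x `^ (- alpha - 1))%:E).
  by move=> mD; apply/measurable_EFinP/measurable_funTS; exact: measurable_stable_integrand.
have mp (p k : R) (D : set R) : measurable D ->
    measurable_fun D (fun x : R => (k%:E * (x `^ p)%:E)%E).
  move=> mD; under eq_fun do rewrite -EFinM.
  by apply/measurable_EFinP/measurable_funTS/measurable_funM.
have p0 (p x : R) : (0 <= (x `^ p)%:E)%E by rewrite lee_fin powR_ge0.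
have -> : (`]0, +oo[%classic : set R) = `]0, c]%classic `|` `]c, +oo[%classic.
  by rewrite -itv_bndbnd_setU// bnd_simp// ltW.
rewrite ge0_integral_setU//=; last 3 first.
- by apply: mf; exact: measurableU.
- by move=> x _; rewrite lee_fin stable_integrand_ge0.
- apply/disj_setPS => x [] /=; rewrite !in_itv/= andbT => /andP[_ xc] cx.
  by move: (lt_le_trans cx xc); rewrite ltxx.
apply: (@le_trans _ _ (((t ^+ 2 / 2) * (c `^ (2 - alpha) / (2 - alpha)))%:E
                       + (2 * (c `^ (- alpha) / alpha))%:E)%E).
  apply: leeD.
    rewrite EFinM -integral_powR_head// -ge0_integralZl//; last 2 first.
      by apply/measurable_EFinP/measurable_funTS; exact: measurable_powR.
      by rewrite lee_fin divr_ge0// sqr_ge0.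
    apply: ge0_le_integral => //.
    - by move=> x _; rewrite lee_fin stable_integrand_ge0.
    - exact: mf.
    - exact: mp.
    - move=> x; rewrite /= in_itv/= => /andP[x0 _]; rewrite -EFinM lee_fin.
      have -> : x `^ (2 - alpha - 1) = x ^+ 2 * x `^ (- alpha - 1).
        rewrite -(powR_mulrn _ (ltW x0)) -powRD; last by rewrite (gt_eqF x0) implybT.
        by congr (_ `^ _); ring.
      rewrite mulrA ler_wpM2r ?powR_ge0// (le_trans (one_sub_cos_le_sqr _))//.
      by rewrite exprMn; lra.
  rewrite EFinM -integral_powR_tail// -ge0_integralZl//; last first.
    by apply/measurable_EFinP/measurable_funTS; exact: measurable_powR.
  apply: (@le_trans _ _ (\int[@lebesgue_measure R]_(x in `]c, +oo[)
      (2%:E * (x `^ (- alpha - 1))%:E))%E).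
    apply: ge0_le_integral => //.
    - by move=> x _; rewrite lee_fin stable_integrand_ge0.
    - exact: mf.
    - exact: mp.
    - by move=> x _; rewrite -EFinM lee_fin ler_wpM2r ?powR_ge0// one_sub_cos_le2.
  apply: ge0_subset_integral => //.
  - exact: mp.
  - by move=> x _; rewrite mule_ge0.
  - by move=> x /=; rewrite !in_itv/= !andbT => /ltW.
rewrite -EFinD lee_fin.
(* With [c = 2 / t] the head and the tail become [2 c^(-alpha) / (2 - alpha)] and
   [2 c^(-alpha) / alpha], which add up to the stated constant. *)
have -> : c `^ (2 - alpha) = c ^+ 2 * c `^ (- alpha).
  by rewrite -(powR_mulrn _ (ltW c0)) -powRD// (gt_eqF c0) implybT.
rewrite le_eqVlt; apply/orP; left; apply/eqP; rewrite /c.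
by field; rewrite ?gt_eqF.
Qed.

Lemma integrable_stable {R : realType} (alpha t : R) : 0 < alpha < 2 ->
  (@lebesgue_measure R).-integrable `]0%R, +oo[
    (fun x => ((1 - cos (t * x)) * x `^ (- alpha - 1))%:E).
Proof.
move=> a02.
wlog t0 : t / 0 <= t => [hw|].
  have [|/ltW t0] := leP 0 t; first exact: hw.
  have := hw (- t); rewrite oppr_ge0 => /(_ t0).
  by apply: eq_integrable => // x _; rewrite mulNr cosN.
move: t0; rewrite le_eqVlt => /predU1P[<-|t0].
  apply: eq_integrable (integrable0 _ _) => // x _.
  by rewrite mul0r cos0 subrr mul0r.
apply/integrableP; split.
  by apply/measurable_EFinP/measurable_funTS; exact: measurable_stable_integrand.
under eq_integral do rewrite gee0_abs ?lee_fin ?stable_integrand_ge0//.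
by rewrite (le_lt_trans (integral_stable_le a02 t0))// ltry.
Qed.

Lemma stable_exponent_le {R : realType} (alpha t : R) : 0 < alpha < 2 -> 0 < t ->
  stable_exponent alpha t <= (2 / t) `^ (- alpha) * (4 / (alpha * (2 - alpha))).
Proof.
move=> a02 t0; rewrite -lee_fin /stable_exponent /Rintegral fineK.
  exact: integral_stable_le.
exact/integrable_fin_num/integrable_stable.
Qed.

(** Substitute [x -> c x]: the power contributes [c^(-alpha-1)], the Jacobian [c], and the prefactor
    [c^alpha] cancels both. *)
Lemma stable_exponent_homogeneous {R : realType} (alpha c : R) : 0 < alpha < 2 -> 0 < c ->
  stable_exponent alpha c = c `^ alpha * stable_exponent alpha 1.
Proof.
move=> a02 c0; rewrite /stable_exponent -RintegralZl//; last exact: integrable_stable.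
rewrite /Rintegral; congr fine; apply/esym.
rewrite (@ge0_integral_dilation _
  (fun x => c `^ alpha * ((1 - cos (1 * x)) * x `^ (- alpha - 1))) _ c0).
- apply: eq_integral => x; rewrite inE/= in_itv/= andbT => x0; congr EFin.
  rewrite mul1r (powRM _ (ltW c0) (ltW x0)).
  have -> : c `^ (- alpha - 1) = (c `^ alpha * c)^-1.
    rewrite -[X in _ * X]powRr1 ?ltW// -powRD; last by rewrite (gt_eqF c0) implybT.
    by rewrite -powRN; congr (_ `^ _); ring.
  by field; rewrite ?gt_eqF ?powR_gt0.
- by move=> x _; rewrite mulr_ge0 ?powR_ge0// stable_integrand_ge0.
- move=> x; rewrite in_itv/= andbT => x0.
  apply: cvgM; first exact: cvg_cst.
  apply: cvgM; last exact: continuous_powR.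
  apply: cvgB; first exact: cvg_cst.
  exact: continuous_cosM.
Qed.

(** * Weighted Fubini theorem *)

Lemma integrable_EFinD d (T : measurableType d) (R : realType)
    (m : {measure set T -> \bar R}) (D : set T) (f g : T -> R) : measurable D ->
  m.-integrable D (EFin \o f) -> m.-integrable D (EFin \o g) ->
  m.-integrable D (EFin \o (fun x => f x + g x)).
Proof. by move=> mD fi gi; apply: eq_integrable (integrableD mD fi gi). Qed.

Lemma integrable_EFinZl d (T : measurableType d) (R : realType)
    (m : {measure set T -> \bar R}) (D : set T) (k : R) (f : T -> R) : measurable D ->
  m.-integrable D (EFin \o f) -> m.-integrable D (EFin \o (fun x => k * f x)).
Proof. by move=> mD fi; apply: eq_integrable (integrableZl mD k fi). Qed.

Lemma integrable_EFinB d (T : measurableType d) (R : realType)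
    (m : {measure set T -> \bar R}) (D : set T) (f g : T -> R) : measurable D ->
  m.-integrable D (EFin \o f) -> m.-integrable D (EFin \o g) ->
  m.-integrable D (EFin \o (fun x => f x - g x)).
Proof. by move=> mD fi gi; apply: eq_integrable (integrableB mD fi gi). Qed.

Lemma integrable_mul_bounded1 d (T : measurableType d) (R : realType)
    (m : {measure set T -> \bar R}) (D : set T) (v h : T -> R) : measurable D ->
  m.-integrable D (EFin \o v) -> measurable_fun D h -> (forall x, `|h x| <= 1) ->
  m.-integrable D (fun x => (v x * h x)%:E).
Proof.
move=> mD iv mh h1; apply: (le_integrable _ _ _ iv) => //.
  apply/measurable_EFinP/measurable_funM => //.
  exact/measurable_EFinP/(measurable_int m).
by move=> x _ /=; rewrite lee_fin normrM ler_piMr.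
Qed.

(** As [|h| <= 1], the integrand is dominated by [|u x| |v y|], whose double integral is a product
    of two finite norms. Integrability of the partially integrated function is recorded too, because
    later comparisons of real-valued integrals require it. *)
Lemma Rfubini_weighted d1 d2 (T1 : measurableType d1) (T2 : measurableType d2)
    (R : realType) (m1 : {sigma_finite_measure set T1 -> \bar R})
    (m2 : {sigma_finite_measure set T2 -> \bar R})
    (u : T1 -> R) (v : T2 -> R) (h : T1 * T2 -> R) :
  m1.-integrable setT (EFin \o u) -> m2.-integrable setT (EFin \o v) ->
  measurable_fun setT h -> (forall z, `|h z| <= 1) ->
  m1.-integrable setT (fun x => (u x * \int[m2]_y (v y * h (x, y)))%:E) /\
  \int[m1]_x (u x * \int[m2]_y (v y * h (x, y))) =
  \int[m2]_y (v y * \int[m1]_x (u x * h (x, y))).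
Proof.
move=> iu iv mh h1.
have mu : measurable_fun setT u by exact/measurable_EFinP/(measurable_int m1).
have mv : measurable_fun setT v by exact/measurable_EFinP/(measurable_int m2).
pose f z : \bar R := (u z.1 * (v z.2 * h z))%:E.
have mf : measurable_fun setT f.
  apply/measurable_EFinP/measurable_funM; first exact: measurableT_comp.
  by apply: measurable_funM => //; exact: measurableT_comp.
have ivh x : m2.-integrable setT (fun y => (v y * h (x, y))%:E).
  by apply: (integrable_mul_bounded1 (h := fun y => h (x, y))) => //;
    exact: measurableT_comp.
have iuh y : m1.-integrable setT (fun x => (u x * h (x, y))%:E).
  by apply: (integrable_mul_bounded1 (h := fun x => h (x, y))) => //;
    exact: measurableT_comp.
have If : (m1 \x m2)%E.-integrable setT f.
  apply/integrable12ltyP => //.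
  apply: (@le_lt_trans _ _
    (\int[m1]_x (`|(u x)%:E| * \int[m2]_y `|(v y)%:E|))%E).
    apply: ge0_le_integral => //.
    - by move=> x _; exact: integral_ge0.
    - apply: (measurable_fun_fubini_tonelli_F (abse \o f)) => //=.
      exact: measurableT_comp.
    - under eq_fun do rewrite muleC.
      apply: measurable_funeM; apply: measurableT_comp => //.
      exact/measurable_EFinP.
    - move=> x _; rewrite -ge0_integralZl//; last first.
        by apply: measurableT_comp => //; exact/measurable_EFinP.
      apply: ge0_le_integral => //.
      + apply: measurableT_comp => //; apply/measurable_EFinP.
        apply: (@measurable_funM _ _ _ _ (cst (u x)) (fun y => v y * h (x, y))) => //.
        by apply: measurable_funM => //; exact: measurableT_comp.
      + apply: measurable_funeM; apply: measurableT_comp => //; exact/measurable_EFinP.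
      + move=> y _ /=; rewrite -EFinM lee_fin !normrM ler_wpM2l//.
        by rewrite ler_piMr.
  move/integrableP : (iu) => [_ iuoo]; move/integrableP : (iv) => [_ ivoo].
  rewrite ge0_integralZr//; last 2 first.
    by apply: measurableT_comp => //; exact/measurable_EFinP.
    exact: integral_ge0.
  by apply: lte_mul_pinfty => //; [exact: integral_ge0|
    rewrite ge0_fin_numE//; exact: integral_ge0].
have FE x : (\int[m2]_y f (x, y) = (u x * \int[m2]_y (v y * h (x, y)))%:E)%E.
  rewrite /f /=; under eq_integral do rewrite EFinM.
  rewrite integralZl// EFinM; congr (_ * _)%E.
  by rewrite /Rintegral fineK//; exact: integrable_fin_num.
have GE y : (\int[m1]_x f (x, y) = (v y * \int[m1]_x (u x * h (x, y)))%:E)%E.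
  rewrite /f /=; under eq_integral do rewrite mulrCA EFinM.
  rewrite integralZl// EFinM; congr (_ * _)%E.
  by rewrite /Rintegral fineK//; exact: integrable_fin_num.
split.
  by have := integrable_fubini_F If; apply: eq_integrable => // x _; exact: FE.
have := Fubini If.
under eq_integral do rewrite FE.
under [in X in _ = X -> _]eq_integral do rewrite GE.
by rewrite /Rintegral => ->.
Qed.

(** * The trapezoid function as a cosine transform *)

(** At index [1] homogeneity is linear, and evenness of the cosine brings in [|c|]. This makes
    absolute values, hence piecewise linear functions, accessible to cosine integrals. *)
Lemma stable_exponent1_norm {R : realType} (c : R) :
  stable_exponent 1 c = `|c| * stable_exponent 1 1.
Proof.
have a02 : 0 < (1 : R) < 2 by lra.
have [c0|c0|->] := ltgtP c 0.
- rewrite ltr0_norm// -(powRr1 (_ : 0 <= - c)) ?oppr_ge0 ?ltW//.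
  rewrite -stable_exponent_homogeneous ?oppr_gt0//.
  by apply: eq_Rintegral => x _; rewrite mulNr cosN.
- by rewrite gtr0_norm// stable_exponent_homogeneous// powRr1// ltW.
- rewrite normr0 mul0r /stable_exponent /Rintegral integral0_eq// => x _.
  by rewrite mul0r cos0 subrr mul0r.
Qed.

(** The constant will be a divisor. It is bounded below on [[1, 2]], inside [[0, pi]] where the
    cosine decreases, by [1 - cos x >= 1 - cos 1] and [x^(-2) >= 1/4]. *)
Lemma stable_exponent11_gt0 {R : realType} : 0 < stable_exponent 1 1 :> R.
Proof.
have a02 : 0 < (1 : R) < 2 by lra.
have cos1 : cos 1 < 1 :> R.
  by rewrite -[ltRHS]cos0 ltr_cos ?in_itv/= ?ler01 ?lexx ?pi_ge0//; have := pi_ge2 R; lra.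
pose k : R := (1 - cos 1) / 4.
have k0 : 0 < k by rewrite divr_gt0// subr_gt0.
rewrite -lte_fin /stable_exponent /Rintegral fineK; last first.
  exact/integrable_fin_num/integrable_stable.
apply: (@lt_le_trans _ _ k%:E) => //.
apply: (@le_trans _ _ (\int[@lebesgue_measure R]_(x in `[1%R, 2%R]) k%:E)%E).
  rewrite integral_cst//= lebesgue_measure_itv/= lte_fin ltr1n -EFinB.
  by rewrite -EFinM lee_fin; lra.
apply: (@le_trans _ _ (\int[@lebesgue_measure R]_(x in `[1%R, 2%R])
    ((1 - cos (1 * x)) * x `^ (- 1 - 1))%:E)%E).
  apply: ge0_le_integral => //.
  - by move=> x _; rewrite lee_fin ltW.
  - by apply/measurable_EFinP/measurable_funTS; exact: measurable_stable_integrand.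
  - move=> x; rewrite /= in_itv/= => /andP[x1 x2]; rewrite lee_fin mul1r.
    have x0 : 0 < x by rewrite (lt_le_trans ltr01).
    have -> : x `^ (- 1 - 1) = (x ^+ 2)^-1.
      rewrite -[RHS]powR_invn ?ltW//; congr (_ `^ _); ring.
    rewrite /k ler_pM ?subr_ge0 ?cos_le1//.
    + rewrite lerB// ; have := pi_ge2 R => p2.
      move: x1; rewrite le_eqVlt => /predU1P[<-//|x1]; apply/ltW.
      by rewrite ltr_cos// in_itv/=; apply/andP; split; lra.
    + by rewrite lef_pV2 ?posrE ?exprn_gt0//; nra.
apply: ge0_subset_integral => //.
- by apply/measurable_EFinP/measurable_funTS; exact: measurable_stable_integrand.
- by move=> x _; rewrite lee_fin stable_integrand_ge0.
- by move=> x /=; rewrite !in_itv/= andbT => /andP[x1 _]; rewrite (lt_le_trans ltr01).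
Qed.

(** For [0 <= a < b] this is the even function equal to [1] on [[-a, a]], to [0] off [[-b, b]], and
    affine in between. The form with four absolute values lets each term be read as a stable
    exponent of index [1]. *)
Definition trapezoid {R : realType} (a b x : R) : R :=
  (`|b + x| + `|b - x| - `|a + x| - `|a - x|) / (2 * (b - a)).

(* [stable_exponent 1 1] is [int_0^oo (1 - cos t) / t^2 dt], the normalising constant. *)
Definition trapezoid_kernel {R : realType} (a b : R) : R -> R :=
  (fun t => (cos (a * t) - cos (b * t)) * t `^ (- 1 - 1)
            / (stable_exponent 1 1 * (b - a))) \_ `]0, +oo[.

(** The difference of cosines is [(1 - cos (b t)) - (1 - cos (a t))], and each part is integrable
    against [t^(-2)]. *)
Lemma integrable_trapezoid_kernel {R : realType} (a b : R) :
  (@lebesgue_measure R).-integrable setT (EFin \o trapezoid_kernel a b).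
Proof.
have a02 : 0 < (1 : R) < 2 by lra.
rewrite /trapezoid_kernel -restrict_EFin.
apply: (iffLR (integrable_mkcond _ _)); first exact: measurable_itv.
pose s (c t : R) := (1 - cos (c * t)) * t `^ (- 1 - 1).
have is_ c : (@lebesgue_measure R).-integrable `]0, +oo[ (EFin \o s c).
  exact: integrable_stable.
have : (@lebesgue_measure R).-integrable `]0, +oo[
    (EFin \o (fun t => (stable_exponent 1 1 * (b - a))^-1 * (s b t - s a t))).
  by apply: integrable_EFinZl => //; exact: integrable_EFinB.
by apply: eq_integrable => // t _ /=; congr EFin; rewrite /s; ring.
Qed.

(** Product-to-sum formulas turn the integrand into a combination of [1 - cos (c t)] with [c] among
    [b + x], [b - x], [a + x], [a - x]; each of these integrates to a multiple of [|c|]. *)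
Lemma trapezoid_fourier {R : realType} (a b x : R) : a < b ->
  \int[@lebesgue_measure R]_t (trapezoid_kernel a b t * cos (t * x)) = trapezoid a b x.
Proof.
move=> ab; have a02 : 0 < (1 : R) < 2 by lra.
have K0 : stable_exponent 1 1 != 0 :> R by rewrite gt_eqF// stable_exponent11_gt0.
have ba0 : b - a != 0 by rewrite subr_eq0 gt_eqF.
(* The factor [2] comes from the product-to-sum formula. *)
pose C := (2 * (stable_exponent 1 1 * (b - a)))^-1.
pose s (c t : R) := (1 - cos (c * t)) * t `^ (- 1 - 1).
have is_ c : (@lebesgue_measure R).-integrable `]0, +oo[ (EFin \o s c).
  exact: integrable_stable.
transitivity (\int[@lebesgue_measure R]_(t in `]0, +oo[)
    (C * (s (b + x) t + s (b - x) t - s (a + x) t - s (a - x) t))).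
  rewrite [RHS]Rintegral_mkcond; apply: eq_Rintegral => t _.
  rewrite /trapezoid_kernel !patchE; case: ifPn => _; last by rewrite mul0r.
  have cD c : cos ((c + x) * t) = cos (c * t) * cos (t * x) - sin (c * t) * sin (t * x).
    by rewrite mulrDl cosD (mulrC x).
  have cB c : cos ((c - x) * t) = cos (c * t) * cos (t * x) + sin (c * t) * sin (t * x).
    by rewrite mulrBl cosB (mulrC x).
  rewrite /s !cD !cB /C.
  by field; rewrite ?K0 ?ba0.
have iD c c' : (@lebesgue_measure R).-integrable `]0, +oo[
    (EFin \o (fun t => s c t + s c' t)) by exact: integrable_EFinD.
have iB c c' c'' : (@lebesgue_measure R).-integrable `]0, +oo[
    (EFin \o (fun t => s c t + s c' t - s c'' t)) by exact: integrable_EFinB.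
rewrite RintegralZl//; last exact: integrable_EFinB.
rewrite RintegralB// RintegralB// RintegralD//.
have E c : \int[@lebesgue_measure R]_(t in `]0, +oo[) s c t = `|c| * stable_exponent 1 1.
  exact: stable_exponent1_norm.
rewrite !E /C /trapezoid.
by field; rewrite ?K0 ?ba0.
Qed.

Lemma trapezoid_le1 {R : realType} (a b x : R) : 0 <= a < b -> trapezoid a b x <= 1.
Proof.
move=> /andP[a0 ab]; rewrite /trapezoid ler_pdivrMr ?mul1r; last by lra.
by case: (ler0P (b + x)); case: (ler0P (b - x)); case: (ler0P (a + x));
  case: (ler0P (a - x)); lra.
Qed.

Lemma trapezoid_ge0 {R : realType} (a b x : R) : 0 <= a < b -> 0 <= trapezoid a b x.
Proof.
move=> /andP[a0 ab]; rewrite /trapezoid divr_ge0//; last by lra.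
by case: (ler0P (b + x)); case: (ler0P (b - x)); case: (ler0P (a + x));
  case: (ler0P (a - x)); lra.
Qed.

Lemma trapezoid_eq1 {R : realType} (a b x : R) : 0 <= a < b -> `|x| <= a ->
  trapezoid a b x = 1.
Proof.
move=> /andP[a0 ab]; rewrite ler_norml => /andP[ax xa]; rewrite /trapezoid.
rewrite !ger0_norm; [|lra..].
by field; rewrite subr_eq0 gt_eqF.
Qed.

Lemma trapezoid_eq0 {R : realType} (a b x : R) : 0 <= a < b -> b <= `|x| ->
  trapezoid a b x = 0.
Proof.
move=> /andP[a0 ab]; rewrite ler_normr => /orP[bx|bx]; rewrite /trapezoid.
  rewrite (ger0_norm (_ : 0 <= b + x)) ?(ler0_norm (_ : b - x <= 0))
    ?(ger0_norm (_ : 0 <= a + x)) ?(ler0_norm (_ : a - x <= 0)); [|lra..].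
  by rewrite (_ : _ - _ = 0) ?mul0r//; ring.
rewrite (ler0_norm (_ : b + x <= 0)) ?(ger0_norm (_ : 0 <= b - x))
    ?(ler0_norm (_ : a + x <= 0)) ?(ger0_norm (_ : 0 <= a - x)); [|lra..].
by rewrite (_ : _ - _ = 0) ?mul0r//; ring.
Qed.

(** One of the two points always lies outside the support: [x + s] when [x >= 0], and [x - s]
    otherwise. This starts the induction on the reflection property. *)
Lemma trapezoid_sum_le1 {R : realType} (a b x s : R) : 0 <= a < b -> b <= s ->
  trapezoid a b (x + s) + trapezoid a b (x - s) <= 1.
Proof.
move=> ab bs; case: (leP 0 x) => x0.
  rewrite (trapezoid_eq0 (x := x + s))// ?add0r ?trapezoid_le1//.
  by rewrite ger0_norm; move/andP: ab => [a0 ab]; lra.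
rewrite (trapezoid_eq0 (x := x - s))// ?addr0 ?trapezoid_le1//.
by rewrite ler0_norm; move/andP: ab => [a0 ab]; lra.
Qed.

(** * Tails are determined by the characteristic function *)

Lemma measurable_set_ge d (T : measurableType d) (R : realType) (W : T -> R) (a : R) :
  measurable_fun setT W -> measurable [set w | a <= W w].
Proof.
move=> mW; have := mW measurableT _ (measurable_itv `[a, +oo[); rewrite setTI.
by congr measurable; apply/seteqP; split => w /=; rewrite in_itv/= andbT.
Qed.

Lemma measurable_set_le d (T : measurableType d) (R : realType) (W : T -> R) (a : R) :
  measurable_fun setT W -> measurable [set w | W w <= a].
Proof.
move=> mW; have := mW measurableT _ (measurable_itv `]-oo, a]); rewrite setTI.
by congr measurable; apply/seteqP; split => w /=; rewrite in_itv.
Qed.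

Lemma measurable_sinM {R : realType} (t : R) :
  measurable_fun setT (fun x : R => sin (t * x)).
Proof.
apply: continuous_measurable_fun => x.
apply: (@continuous_comp _ _ _ (fun x => t * x)); last exact: continuous_sin.
by apply: cvgM; [exact: cvg_cst|exact: cvg_id].
Qed.

Lemma measurable_cos_real {R : realType} : measurable_fun setT (@cos R).
Proof. by apply: continuous_measurable_fun; exact: continuous_cos. Qed.

Lemma integrable_bounded1 d (T : measurableType d) (R : realType)
    (P : probability T R) (h : T -> R) :
  measurable_fun setT h -> (forall x, `|h x| <= 1) ->
  P.-integrable setT (EFin \o h).
Proof.
move=> mh h1.
have := @integrable_mul_bounded1 _ _ _ P setT (cst 1) h measurableT.
move=> /(_ (finite_measure_integrable_cst _ _ measurableT) mh h1).
by apply: eq_integrable => // x _; rewrite mul1r.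
Qed.

(** After Fubini the inner expectation is that of [cos (t (W - c))]; the addition formula leaves
    [cos (t c) * phi t], since the sine part has mean zero. *)
Lemma expectation_trapezoid d (T : measurableType d) (R : realType)
    (P : probability T R) (W : T -> R) (phi : R -> R) (a b c : R) :
  measurable_fun setT W ->
  (forall t, \int[P]_w cos (t * W w) = phi t) ->
  (forall t, \int[P]_w sin (t * W w) = 0) -> a < b ->
  \int[P]_w trapezoid a b (W w - c) =
  \int[@lebesgue_measure R]_t (trapezoid_kernel a b t * (cos (t * c) * phi t)).
Proof.
move=> mW hcos hsin ab.
have mh : measurable_fun [set: T * R] (fun z => cos (z.2 * (W z.1 - c))).
  apply: (@measurableT_comp _ _ _ _ _ _ (@cos R)); first exact: measurable_cos_real.
  apply: measurable_funM => //; apply: measurable_funB => //.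
  exact: measurableT_comp.
have [_] := @Rfubini_weighted _ _ _ _ _ P (@lebesgue_measure R)
  (cst 1) (trapezoid_kernel a b) _
  (finite_measure_integrable_cst P 1 measurableT)
  (integrable_trapezoid_kernel a b) mh (fun z => cos_max _).
have icos t : P.-integrable setT (EFin \o (fun w => cos (t * c) * cos (t * W w))).
  apply: integrable_EFinZl => //; apply: integrable_bounded1 => [|w]; last exact: cos_max.
  exact: (measurableT_comp (measurable_cosM t)).
have isin t : P.-integrable setT (EFin \o (fun w => sin (t * c) * sin (t * W w))).
  apply: integrable_EFinZl => //; apply: integrable_bounded1 => [|w]; last exact: sin_max.
  exact: (measurableT_comp (measurable_sinM t)).
have inner t : \int[P]_w (cst 1 w * cos (t * (W w - c))) = cos (t * c) * phi t.
  transitivity (\int[P]_w (cos (t * c) * cos (t * W w) + sin (t * c) * sin (t * W w))).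
    by apply: eq_Rintegral => w _; rewrite mul1r mulrBr cosB; ring.
  rewrite RintegralD// RintegralZl//; last first.
    apply: integrable_bounded1 => [|w]; last exact: cos_max.
    exact: (measurableT_comp (measurable_cosM t)).
  rewrite RintegralZl//; last first.
    apply: integrable_bounded1 => [|w]; last exact: sin_max.
    exact: (measurableT_comp (measurable_sinM t)).
  by rewrite hcos hsin mulr0 addr0.
under [in X in _ = X -> _]eq_Rintegral do rewrite inner.
move=> <-; apply: eq_Rintegral => w _ /=.
by rewrite mul1r trapezoid_fourier.
Qed.

Lemma measurable_trapezoid {R : realType} (a b : R) :
  measurable_fun setT (@trapezoid R a b).
Proof.
rewrite /trapezoid; apply: measurable_funM => //.
have mD c : measurable_fun [set: R] (fun x => `|c + x|).
  by apply: measurableT_comp => //; exact: measurable_funD.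
have mB c : measurable_fun [set: R] (fun x => `|c - x|).
  by apply: measurableT_comp => //; exact: measurable_funB.
exact: (measurable_funB (measurable_funB (measurable_funD (mD b) (mB b)) (mD a)) (mB a)).
Qed.

Lemma norm_trapezoid_le1 {R : realType} (a b x : R) : 0 <= a < b ->
  `|trapezoid a b x| <= 1.
Proof. by move=> ab; rewrite ger0_norm ?trapezoid_le1 ?trapezoid_ge0. Qed.

Lemma expectation_trapezoidE d (T : measurableType d) (R : realType)
    (P : probability T R) (W : T -> R) (a b c : R) :
  measurable_fun setT W -> 0 <= a < b ->
  ((\int[P]_w trapezoid a b (W w - c))%R%:E
   = \int[P]_w (trapezoid a b (W w - c))%:E)%E.
Proof.
move=> mW ab; rewrite /Rintegral fineK//.
apply: integrable_fin_num => //; apply: integrable_bounded1 => [|w].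
  apply: (measurableT_comp (measurable_trapezoid a b)).
  exact: measurable_funB.
exact: norm_trapezoid_le1.
Qed.

Lemma trapezoid_ge_probability d (T : measurableType d) (R : realType)
    (P : probability T R) (W : T -> R) (a b c : R) :
  measurable_fun setT W -> 0 <= a < b ->
  (P [set w | `|W w - c| <= a]%R <= (\int[P]_w trapezoid a b (W w - c))%R%:E)%E.
Proof.
move=> mW ab.
have mWc : measurable_fun setT (fun w => `|W w - c|).
  by apply: measurableT_comp => //; exact: measurable_funB.
have mA : measurable [set w | `|W w - c| <= a].
  exact: measurable_set_le.
rewrite expectation_trapezoidE// -[X in P X]setIT -integral_indic//.
apply: ge0_le_integral => //.
- exact/measurable_EFinP.
- apply/measurable_EFinP/(measurableT_comp (measurable_trapezoid a b)).
  exact: measurable_funB.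
- move=> w _; rewrite lee_fin indicE; have [|_] := boolP (w \in _).
    by rewrite inE/= => wa; rewrite trapezoid_eq1.
  exact: trapezoid_ge0.
Qed.

Lemma trapezoid_le_probability d (T : measurableType d) (R : realType)
    (P : probability T R) (W : T -> R) (a b c : R) (A : set T) :
  measurable_fun setT W -> 0 <= a < b -> measurable A ->
  (forall w, `|W w - c| <= b -> A w) ->
  ((\int[P]_w trapezoid a b (W w - c))%R%:E <= P A)%E.
Proof.
move=> mW ab mA hA.
rewrite expectation_trapezoidE// -[X in P X]setIT -integral_indic//.
apply: ge0_le_integral => //.
- by move=> w _; rewrite lee_fin trapezoid_ge0.
- apply/measurable_EFinP/(measurableT_comp (measurable_trapezoid a b)).
  exact: measurable_funB.
- exact/measurable_EFinP.
- move=> w _; rewrite lee_fin indicE; have [_|] := boolP (w \in _).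
    exact: trapezoid_le1.
  rewrite notin_setE => nA; rewrite trapezoid_eq0// leNgt; apply/negP => /ltW.
  by move/hA.
Qed.

(* Trapezoids that are [1] on [[y, y + 2n]] and vanish to the left of [z]. *)
Lemma tail_le_of_same_charfun d (T : measurableType d) (R : realType)
    (P : probability T R) (W V : T -> R) (phi : R -> R) (y z : R) :
  measurable_fun setT W -> measurable_fun setT V ->
  (forall t, \int[P]_w cos (t * W w) = phi t) ->
  (forall t, \int[P]_w sin (t * W w) = 0) ->
  (forall t, \int[P]_w cos (t * V w) = phi t) ->
  (forall t, \int[P]_w sin (t * V w) = 0) ->
  z < y ->
  (P [set w | y <= W w]%R <= P [set w | z <= V w]%R)%E.
Proof.
move=> mW mV Wc Ws Vc Vs zy.
have mV' : measurable [set w | z <= V w].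
  exact: measurable_set_ge.
pose F n := [set w | `|W w - (y + n%:R)| <= n%:R].
have FE n : F n = [set w | y <= W w <= y + n%:R + n%:R].
  apply/seteqP; split => w; rewrite /F/= ler_norml => /andP[h1 h2]; apply/andP; split; lra.
have mF n : measurable (F n).
  apply: measurable_set_le; by apply: measurableT_comp => //; exact: measurable_funB.
have FU : \bigcup_n F n = [set w | y <= W w].
  apply/seteqP; split => w /=.
    by move=> [n _]; rewrite FE/= => /andP[].
  move=> yW; have Wy : 0 <= W w - y by rewrite subr_ge0.
  exists (Num.bound (W w - y)) => //; rewrite FE/= yW/=.
  by have := archi_boundP Wy; set n := _%:R; lra.
rewrite -FU.
have cF : (P \o F) n @[n --> \oo] --> P (\bigcup_n F n).
  apply: nondecreasing_cvg_mu => //; first exact: bigcupT_measurable.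
  move=> m n mn; apply/subsetPset => w; rewrite !FE/= => /andP[-> h]/=.
  by rewrite -(ler_nat R) in mn; lra.
rewrite -(cvg_lim _ cF)//; apply: lime_le; first by apply/cvg_ex; eexists; exact: cF.
apply: nearW => n /=.
have ab : 0 <= (n%:R : R) < n%:R + (y - z) by rewrite ler0n/= ltrDl subr_gt0.
apply: (le_trans (trapezoid_ge_probability P (y + n%:R) mW ab)).
have ab' : n%:R < n%:R + (y - z) by rewrite ltrDl subr_gt0.
(* Both expectations are the same integral against [phi], so [W] can be exchanged for [V]. *)
rewrite (expectation_trapezoid _ mW Wc Ws ab') -(expectation_trapezoid _ mV Vc Vs ab').
apply: trapezoid_le_probability => // w; rewrite ler_norml => /andP[h _] /=; lra.
Qed.

(** * Averaging over a symmetrised Pareto law *)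

(** Only the law of the jump size is encoded; the random sign enters through the averages of the
    values at [x + s] and [x - s]. *)
Definition pareto {R : realType} (alpha e : R) : R -> R :=
  (fun s => alpha * e `^ alpha * s `^ (- alpha - 1)) \_ `[e, +oo[.

Lemma pareto_ge0 {R : realType} (alpha e s : R) : 0 < alpha -> 0 <= pareto alpha e s.
Proof.
move=> a0; rewrite /pareto patchE; case: ifPn => // _.
by rewrite !mulr_ge0 ?powR_ge0// ltW.
Qed.

Lemma integrable_powR_tail {R : realType} (alpha c : R) : 0 < alpha -> 0 < c ->
  (@lebesgue_measure R).-integrable `[c, +oo[ (EFin \o (fun s => s `^ (- alpha - 1))).
Proof.
move=> a0 c0; apply/integrableP; split.
  by apply/measurable_EFinP/measurable_funTS; exact: measurable_powR.
under eq_integral do rewrite gee0_abs ?lee_fin ?powR_ge0//.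
by rewrite integral_powR_tail// ltry.
Qed.

Lemma integrable_pareto {R : realType} (alpha e : R) : 0 < alpha -> 0 < e ->
  (@lebesgue_measure R).-integrable setT (EFin \o pareto alpha e).
Proof.
move=> a0 e0; rewrite /pareto -restrict_EFin.
apply: (iffLR (integrable_mkcond _ _)); first exact: measurable_itv.
by apply: integrable_EFinZl => //; exact: integrable_powR_tail.
Qed.

Lemma Rintegral_pareto_tail {R : realType} (alpha e b : R) :
  0 < alpha -> 0 < e -> e <= b ->
  \int[@lebesgue_measure R]_(s in `[b, +oo[) pareto alpha e s = e `^ alpha * b `^ (- alpha).
Proof.
move=> a0 e0 eb; have b0 := lt_le_trans e0 eb.
transitivity (\int[@lebesgue_measure R]_(s in `[b, +oo[)
    (alpha * e `^ alpha * s `^ (- alpha - 1))).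
  apply: eq_Rintegral => s; rewrite inE/= in_itv/= andbT => bs.
  by rewrite /pareto patchE mem_set//= in_itv/= andbT (le_trans eb).
rewrite RintegralZl//; last exact: integrable_powR_tail.
rewrite {1}/Rintegral integral_powR_tail//=.
by field; rewrite gt_eqF.
Qed.

Lemma Rintegral_pareto {R : realType} (alpha e : R) : 0 < alpha -> 0 < e ->
  \int[@lebesgue_measure R]_s pareto alpha e s = 1.
Proof.
move=> a0 e0; transitivity (\int[@lebesgue_measure R]_(s in `[e, +oo[) pareto alpha e s).
  rewrite [RHS]Rintegral_mkcond; apply: eq_Rintegral => s _.
  by rewrite /pareto !patchE; case: ifPn => // se; rewrite patchE se.
rewrite Rintegral_pareto_tail// -powRD; last by rewrite (gt_eqF e0) implybT.
by rewrite subrr powRr0.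
Qed.

Definition cos_transform {R : realType} (f : R -> R) (x : R) : R :=
  \int[@lebesgue_measure R]_t (f t * cos (t * x)).

(** Since [cos (t (x + s)) + cos (t (x - s)) = 2 cos (t x) cos (t s)], Fubini shows that multiplying
    [f] by the transform of [w] averages the transform of [f] over symmetric jumps with weight
    [w]. *)
Lemma cos_transform_average {R : realType} (w f : R -> R) (x : R) :
  (@lebesgue_measure R).-integrable setT (EFin \o w) ->
  (@lebesgue_measure R).-integrable setT (EFin \o f) ->
  (@lebesgue_measure R).-integrable setT (EFin \o (fun s =>
     w s * ((cos_transform f (x + s) + cos_transform f (x - s)) / 2))) /\
  cos_transform (fun t => f t * cos_transform w t) x =
  \int[@lebesgue_measure R]_s
    (w s * ((cos_transform f (x + s) + cos_transform f (x - s)) / 2)).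
Proof.
move=> iw i_f.
have ifc y : (@lebesgue_measure R).-integrable setT (EFin \o (fun t => f t * cos (t * y))).
  apply: integrable_mul_bounded1 => // [|t]; last exact: cos_max.
  by under eq_fun do rewrite mulrC; exact: measurable_cosM.
have mh : measurable_fun [set: R * R] (fun z => cos (z.2 * z.1)).
  apply: (@measurableT_comp _ _ _ _ _ _ (@cos R)); first exact: measurable_cos_real.
  exact: measurable_funM.
have [I E] := @Rfubini_weighted _ _ _ _ _ (@lebesgue_measure R) (@lebesgue_measure R)
  w (fun t => f t * cos (t * x)) _ iw (ifc x) mh (fun z => cos_max _).
have inner s : (cos_transform f (x + s) + cos_transform f (x - s)) / 2 =
    \int[@lebesgue_measure R]_t (f t * cos (t * x) * cos (t * s)).
  rewrite /cos_transform -RintegralD// mulrC -RintegralZl//; last exact: integrable_EFinD.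
  by apply: eq_Rintegral => t _; rewrite (mulrDr t) (mulrBr t) cosD cosB; field.
split.
  by apply: eq_integrable I => // s _ /=; rewrite inner.
transitivity (\int[@lebesgue_measure R]_s
    (w s * \int[@lebesgue_measure R]_t (f t * cos (t * x) * cos (t * s)))); last first.
  by apply: eq_Rintegral => s _; rewrite inner.
rewrite E; apply: eq_Rintegral => t _.
rewrite -mulrA [cos_transform w t * _]mulrC mulrA; congr (_ * _).
by apply: eq_Rintegral => s _; rewrite /= [s * t]mulrC.
Qed.

(** For a jump size [r] the four values at [x + s + r], [x + s - r], [x - s + r], [x - s - r]
    regroup into two pairs symmetric about [x + r] and about [x - r], and each pair sums to at most
    [1]. *)
Lemma average_sum_le1 {R : realType} (w g h : R -> R) (b x s : R) :
  (forall s, 0 <= w s) ->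
  (@lebesgue_measure R).-integrable setT (EFin \o w) ->
  \int[@lebesgue_measure R]_s w s = 1 ->
  (forall x, (@lebesgue_measure R).-integrable setT (EFin \o (fun s =>
     w s * ((g (x + s) + g (x - s)) / 2)))) ->
  (forall x, h x = \int[@lebesgue_measure R]_s (w s * ((g (x + s) + g (x - s)) / 2))) ->
  (forall x s, b <= s -> g (x + s) + g (x - s) <= 1) ->
  b <= s -> h (x + s) + h (x - s) <= 1.
Proof.
move=> w0 iw w1 ig hE g1 bs; rewrite !hE -RintegralD//; try exact: ig.
rewrite -[leRHS]w1; apply: le_Rintegral => //; first exact: integrable_EFinD.
move=> r _; rewrite -mulrDr ler_piMr//.
have := g1 (x + r) s bs; have := g1 (x - r) s bs.
rewrite (_ : x - r + s = x + s - r); last by ring.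
rewrite (_ : x - r - s = x - s - r); last by ring.
rewrite (_ : x + r + s = x + s + r); last by ring.
by rewrite (_ : x + r - s = x - s + r); [lra|ring].
Qed.

(** Jumps below [b] are charged the uniform bound [D]; those of size at least [b], of total mass
    [p], cost only [1/2] once both signs are averaged. *)
Lemma average_le {R : realType} (w g : R -> R) (b p D x : R) :
  (forall s, 0 <= w s) ->
  (@lebesgue_measure R).-integrable setT (EFin \o w) ->
  \int[@lebesgue_measure R]_s w s = 1 ->
  \int[@lebesgue_measure R]_(s in `[b, +oo[) w s = p ->
  (@lebesgue_measure R).-integrable setT (EFin \o (fun s =>
     w s * ((g (x + s) + g (x - s)) / 2))) ->
  (forall x, g x <= D) ->
  (forall s, b <= s -> g (x + s) + g (x - s) <= 1) ->
  \int[@lebesgue_measure R]_s (w s * ((g (x + s) + g (x - s)) / 2))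
    <= (1 - p) * D + p / 2.
Proof.
move=> w0 iw w1 wp ig gD g1.
have iwb : (@lebesgue_measure R).-integrable setT (EFin \o (w \_ `[b, +oo[)).
  rewrite -restrict_EFin; apply: (iffLR (integrable_mkcond _ _)) => //.
  exact: integrableS iw.
(* The bound is rewritten as the integral of a majorant: [D w] below [b], and [w / 2] from [b]
   on. *)
have -> : (1 - p) * D + p / 2 =
    \int[@lebesgue_measure R]_s (D * w s + (2^-1 - D) * (w \_ `[b, +oo[) s).
  rewrite RintegralD//; [|exact: integrable_EFinZl..].
  by rewrite !RintegralZl// -Rintegral_mkcond w1 wp; field.
apply: le_Rintegral => //.
  by apply: integrable_EFinD => //; exact: integrable_EFinZl.
move=> s _; rewrite patchE; case: ifPn => [|_].
  rewrite inE/= in_itv/= andbT => bs.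
  rewrite (_ : D * w s + (2^-1 - D) * w s = w s * 2^-1); last by ring.
  rewrite ler_wpM2l//.
  by have := g1 _ bs; lra.
rewrite mulr0 addr0 mulrC ler_wpM2r//.
by have := gD (x + s); have := gD (x - s); lra.
Qed.

(** Tonelli's measurability statement concerns nonnegative functions, so the integral is split into
    its positive and negative parts. *)
Lemma measurable_cos_transform {R : realType} (w : R -> R) :
  measurable_fun setT w -> measurable_fun setT (cos_transform w).
Proof.
move=> mw; pose f (z : R * R) := (w z.2 * cos (z.2 * z.1))%:E.
have mf : measurable_fun setT f.
  apply/measurable_EFinP/measurable_funM; first exact: measurableT_comp.
  apply: (@measurableT_comp _ _ _ _ _ _ (@cos R)); first exact: measurable_cos_real.
  exact: measurable_funM.
have -> : cos_transform w = fine \o (fun t : R =>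
    \int[@lebesgue_measure R]_s f^\+ (t, s) - \int[@lebesgue_measure R]_s f^\- (t, s))%E.
  apply/funext => t; rewrite /cos_transform /Rintegral /= integralE.
  by congr (fine (_ - _)%E); apply: eq_integral => s _; rewrite ?funeposE ?funenegE.
apply: measurableT_comp; first exact: fine_measurable.
apply: emeasurable_funB.
- apply: (measurable_fun_fubini_tonelli_F (m2 := @lebesgue_measure R) (f^\+)%E) => //.
  exact: measurable_funepos.
- apply: (measurable_fun_fubini_tonelli_F (m2 := @lebesgue_measure R) (f^\-)%E) => //.
  exact: measurable_funeneg.
Qed.

Lemma cos_transform_le1 {R : realType} (w : R -> R) (t : R) :
  (forall s, 0 <= w s) ->
  (@lebesgue_measure R).-integrable setT (EFin \o w) ->
  \int[@lebesgue_measure R]_s w s = 1 -> `|cos_transform w t| <= 1.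
Proof.
move=> w0 iw w1.
have iwc : (@lebesgue_measure R).-integrable setT (EFin \o (fun s => w s * cos (s * t))).
  apply: integrable_mul_bounded1 => // [|s]; last exact: cos_max.
  by under eq_fun do rewrite mulrC; exact: measurable_cosM.
rewrite (le_trans (le_normr_Rintegral _ iwc))// -[leRHS]w1.
apply: le_Rintegral => //; first exact: (integrable_norm iwc).
by move=> s _; rewrite normrM ger0_norm// ler_piMr// cos_max.
Qed.

Lemma integrable_mul_cos_transformX {R : realType} (w f : R -> R) (n : nat) :
  (forall s, 0 <= w s) ->
  (@lebesgue_measure R).-integrable setT (EFin \o w) ->
  \int[@lebesgue_measure R]_s w s = 1 ->
  (@lebesgue_measure R).-integrable setT (EFin \o f) ->
  (@lebesgue_measure R).-integrable setT (EFin \o (fun t => f t * cos_transform w t ^+ n)).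
Proof.
move=> w0 iw w1 i_f; apply: integrable_mul_bounded1 => // [|t].
  apply: measurable_funX; apply: measurable_cos_transform.
  by move/measurable_int : iw => /measurable_EFinP.
by rewrite normrX exprn_ile1// cos_transform_le1.
Qed.

(** [G m] is the [m]-fold symmetric average of the trapezoid. Both claims are proved together
    because the uniform bound at [n + 1] uses the pair bound at [n]. *)
Lemma cos_transform_iterate {R : realType} (alpha e a b : R) (n : nat) :
  0 < alpha -> 0 < e -> e <= b -> 0 <= a < b ->
  let G m := cos_transform (fun t =>
    trapezoid_kernel a b t * cos_transform (pareto alpha e) t ^+ m) in
  (forall x s, b <= s -> G n (x + s) + G n (x - s) <= 1) /\
  (forall x, G n x <= 2^-1 + (1 - e `^ alpha * b `^ (- alpha)) ^+ n / 2).
Proof.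
move=> a0 e0 eb ab G.
have iw := integrable_pareto a0 e0.
have w0 s := @pareto_ge0 _ alpha e s a0.
have w1 := Rintegral_pareto a0 e0.
have wp := Rintegral_pareto_tail a0 e0 eb.
set p := e `^ alpha * b `^ (- alpha) in wp *.
have iG m := integrable_mul_cos_transformX m w0 iw w1 (integrable_trapezoid_kernel a b).
have GS m x : (@lebesgue_measure R).-integrable setT (EFin \o (fun s =>
      pareto alpha e s * ((G m (x + s) + G m (x - s)) / 2))) /\
    G m.+1 x = \int[@lebesgue_measure R]_s
      (pareto alpha e s * ((G m (x + s) + G m (x - s)) / 2)).
  have [I E] := cos_transform_average x iw (iG m); split => //.
  by rewrite -E; apply: eq_Rintegral => t _; rewrite exprSr mulrA.
elim: n => [|n [IH1 IH2]].
  have G0 x : G 0%N x = trapezoid a b x.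
    rewrite -trapezoid_fourier; last by case/andP: ab.
    by apply: eq_Rintegral => t _; rewrite expr0 mulr1.
  split=> [x s bs|x]; rewrite !G0; first exact: trapezoid_sum_le1.
  by have := trapezoid_le1 x ab; rewrite expr0; lra.
split=> [x s bs|x].
  apply: (@average_sum_le1 _ (pareto alpha e) (G n) (G n.+1) b x s) => // y.
    exact: (GS n y).1.
  exact: (GS n y).2.
(* The bound [1/2 + (1 - p)^n / 2] is carried exactly to the next index by
   [D -> (1 - p) D + p / 2]. *)
rewrite (GS n x).2; apply: (le_trans (average_le w0 iw w1 wp (GS n x).1 IH2 (IH1 x))).
by rewrite exprS; lra.
Qed.

(** * Convergence of Pareto sums to the stable law *)

(** With [x = u n / (n + 1)], the powers are squeezed through [exp (- x / (1 - x)) <= 1 - x <= exp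
    (- x)]. *)
Lemma cvg_expR_compound {R : realType} (u : nat -> R) (l : R) :
  (forall n, 0 <= u n) -> u @ \oo --> l ->
  (1 - u n / n.+1%:R) ^+ n.+1 @[n --> \oo] --> expR (- l).
Proof.
move=> u0 ul.
have un0 : u n / n.+1%:R @[n --> \oo] --> (0 : R).
  rewrite -(mulr0 l); apply: cvgM => //; exact: cvg_harmonic.
have cexp (v : nat -> R) m : v @ \oo --> m -> expR (v n) @[n --> \oo] --> expR m.
  by move=> vm; apply: (cvg_comp v (@expR R) vm); exact: continuous_expR.
have lo : expR (- (u n / (1 - u n / n.+1%:R))) @[n --> \oo] --> expR (- l).
  apply: cexp; apply: cvgN; rewrite -[X in _ --> X]divr1; apply: cvgM => //.
  apply: cvgV; first exact: oner_neq0.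
  by rewrite -[X in _ --> X]subr0; apply: cvgB => //; exact: cvg_cst.
have hi : expR (- u n) @[n --> \oo] --> expR (- l).
  by apply: cexp; exact: cvgN.
apply: squeeze_cvgr lo hi; near=> n.
have x1 : u n / n.+1%:R < 1 by near: n; apply: cvgr_lt un0 _ _; exact: ltr01.
set x := u n / n.+1%:R in x1 *.
have uE : u n = n.+1%:R * x by rewrite /x mulrC divfK// pnatr_eq0.
have y0 : 0 < 1 - x by rewrite subr_gt0.
clearbody x.
have -> : - (u n / (1 - x)) = n.+1%:R * - (x / (1 - x)) by rewrite uE; ring.
have -> : - u n = n.+1%:R * - x by rewrite uE; ring.
rewrite !expRM_natl; apply/andP; split.
  apply: lerXn2r; rewrite ?nnegrE ?expR_ge0 ?(ltW y0)//.
  (* After inversion the lower bound is [exp z >= 1 + z] at [z = x / (1 - x)], where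
     [1 + z = 1 / (1 - x)]. *)
  rewrite expRN -[leRHS]invrK lef_pV2 ?posrE ?expR_gt0 ?invr_gt0//.
  apply: le_trans (expR_ge1Dx _).
  by rewrite le_eqVlt; apply/orP; left; apply/eqP; field; rewrite gt_eqF.
apply: lerXn2r; rewrite ?nnegrE ?expR_ge0 ?(ltW y0)//.
exact: expR_ge1Dx.
Unshelve. all: by end_near. Qed.

(* Chosen so that [alpha * cutoff ^ alpha = 2 / n.+1]: the Levy measure has mass
   [n.+1] outside [[-cutoff, cutoff]]. *)
Definition cutoff {R : realType} (alpha : R) (n : nat) : R :=
  (2 / (alpha * n.+1%:R)) `^ alpha^-1.

Lemma cutoff_gt0 {R : realType} (alpha : R) n : 0 < alpha -> 0 < cutoff alpha n.
Proof. by move=> a0; rewrite powR_gt0// divr_gt0// mulr_gt0. Qed.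

Lemma cutoff_powR {R : realType} (alpha : R) n : 0 < alpha ->
  cutoff alpha n `^ alpha = 2 / (alpha * n.+1%:R).
Proof.
move=> a0; rewrite /cutoff -powRrM mulVf ?gt_eqF// powRr1//.
by rewrite divr_ge0// mulr_ge0// ltW.
Qed.

Lemma cutoff_decreasing {R : realType} (alpha : R) m n : 0 < alpha -> (m <= n)%N ->
  cutoff alpha n <= cutoff alpha m.
Proof.
move=> a0 mn; rewrite /cutoff ge0_ler_powR// ?nnegrE ?invr_ge0 ?divr_ge0 ?mulr_ge0 ?(ltW a0)//.
rewrite ler_pM2l// lef_pV2 ?posrE ?mulr_gt0//.
by rewrite ler_pM2l// ler_nat ltnS.
Qed.

Lemma cutoff_le_near {R : realType} (alpha b : R) : 0 < alpha -> 0 < b ->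
  exists N, forall n, (N <= n)%N -> cutoff alpha n <= b.
Proof.
move=> a0 b0; have ba0 : 0 < b `^ alpha by rewrite powR_gt0.
(* By [cutoff_powR], the cutoff is at most [b] as soon as [n + 1 >= 2 / (alpha b^alpha)]. *)
exists (Num.bound (2 / (alpha * b `^ alpha))) => n hn.
have c0 := ltW (cutoff_gt0 n a0).
rewrite leNgt; apply/negP => /(gt0_ltr_powR a0).
rewrite !nnegrE => /(_ (ltW b0) c0); rewrite cutoff_powR//.
rewrite ltr_pdivlMr ?mulr_gt0//.
have q0 : 0 <= 2 / (alpha * b `^ alpha) by rewrite divr_ge0// mulr_ge0// ltW.
have := archi_boundP q0; rewrite ltr_pdivrMr ?mulr_gt0// => h1 h2.
have : (Num.bound (2 / (alpha * b `^ alpha)))%:R <= n.+1%:R :> R by rewrite ler_nat ltnW.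
move=> h3; suff : b `^ alpha * (alpha * n.+1%:R) < n.+1%:R * (alpha * b `^ alpha).
  by rewrite mulrA mulrC (mulrC alpha) ltxx.
apply: (lt_le_trans h2); apply: (le_trans (ltW h1)).
by rewrite ler_wpM2r// mulr_ge0// ltW.
Qed.

Definition truncated_exponent {R : realType} (alpha e t : R) : R :=
  \int[@lebesgue_measure R]_(x in `[e, +oo[) ((1 - cos (t * x)) * x `^ (- alpha - 1)).

Lemma truncated_exponent_cvg {R : realType} (alpha t : R) : 0 < alpha < 2 ->
  truncated_exponent alpha (cutoff alpha n) t @[n --> \oo] --> stable_exponent alpha t.
Proof.
move=> a02; have /andP[a0 _] := a02.
have sub (r : R) : 0 < r -> (`[r, +oo[ : set R) `<=` `]0%R, +oo[.
  by move=> r0 x /=; rewrite !in_itv/= !andbT; exact: lt_le_trans.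
apply: (@fine_cvg _ _ _ _ (fun n => (\int[@lebesgue_measure R]_(x in `[cutoff alpha n, +oo[)
   ((1 - cos (t * x)) * x `^ (- alpha - 1))%:E)%E)).
rewrite /stable_exponent /Rintegral fineK; last first.
  exact/integrable_fin_num/integrable_stable.
have -> : (`]0, +oo[%classic : set R) = \bigcup_n `[cutoff alpha n, +oo[%classic.
  apply/seteqP; split => x; last by move=> [n _]; exact/sub/cutoff_gt0.
  rewrite /= in_itv/= andbT => x0; have [N hN] := cutoff_le_near a0 x0.
  by exists N => //=; rewrite in_itv/= andbT; exact: hN.
apply: ge0_nondecreasing_set_cvg_integral => //.
- move=> m n mn; apply/subsetPset => x /=; rewrite !in_itv/= !andbT.
  by apply: le_trans; exact: cutoff_decreasing.
- by move=> n; apply/measurable_EFinP/measurable_funTS; exact: measurable_stable_integrand.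
- by move=> n x _; rewrite lee_fin stable_integrand_ge0.
Qed.

Lemma cos_transform_pareto {R : realType} (alpha e t : R) : 0 < alpha < 2 -> 0 < e ->
  cos_transform (pareto alpha e) t = 1 - alpha * e `^ alpha * truncated_exponent alpha e t.
Proof.
move=> a02 e0; have /andP[a0 _] := a02.
have iw := integrable_pareto a0 e0.
have iwc : (@lebesgue_measure R).-integrable setT
    (EFin \o (fun s => pareto alpha e s * cos (s * t))).
  apply: integrable_mul_bounded1 => // [|s]; last exact: cos_max.
  by under eq_fun do rewrite mulrC; exact: measurable_cosM.
have ist : (@lebesgue_measure R).-integrable `[e, +oo[
    (EFin \o (fun x => (1 - cos (t * x)) * x `^ (- alpha - 1))).
  apply: integrableS (integrable_stable t a02) => //.
  by move=> x /=; rewrite !in_itv/= !andbT; exact: lt_le_trans.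
apply/eqP; rewrite eq_sym subr_eq addrC -subr_eq; apply/eqP.
rewrite -[X in X - _](Rintegral_pareto a0 e0) /cos_transform -RintegralB//.
rewrite /truncated_exponent -RintegralZl// [RHS]Rintegral_mkcond.
apply: eq_Rintegral => s _; rewrite /pareto !patchE; case: ifPn => _.
  by rewrite (mulrC s); ring.
by rewrite mul0r subr0.
Qed.

(** The choice of [cutoff] turns the transform into [1 - 2 psi_n / (n + 1)], with [psi_n] the
    truncated exponent, so the compound limit applies. *)
Lemma cos_transform_pareto_cvg {R : realType} (alpha t : R) : 0 < alpha < 2 ->
  cos_transform (pareto alpha (cutoff alpha n)) t ^+ n.+1 @[n --> \oo]
    --> expR (- 2 * stable_exponent alpha t).
Proof.
move=> a02; have /andP[a0 _] := a02.
have := @cvg_expR_compound R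
  (fun n => 2 * truncated_exponent alpha (cutoff alpha n) t) (2 * stable_exponent alpha t).
have t0 n : 0 <= 2 * truncated_exponent alpha (cutoff alpha n) t.
  by rewrite mulr_ge0//; apply: Rintegral_ge0 => x _; exact: stable_integrand_ge0.
move=> /(_ t0); rewrite mulNr => h.
have {}h := h _; apply: cvg_trans (h _); last first.
  by apply: cvgM; [exact: cvg_cst|exact: truncated_exponent_cvg].
apply: near_eq_cvg; apply: nearW => n.
rewrite cos_transform_pareto ?cutoff_gt0// cutoff_powR//; congr ((1 - _) ^+ _).
have E (N A S : R) : N != 0 -> A != 0 -> 2 * S / N = A * (2 / (A * N)) * S.
  by move=> N0 A0; field; rewrite N0 A0.
by apply: E; rewrite ?pnatr_eq0 ?gt_eqF.
Qed.

(** All the approximating integrands are dominated by the absolute value of the kernel, so the bound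
    on the iterates at [x = 0] passes to the limit. *)
Lemma stable_trapezoid_le {R : realType} (alpha a b : R) :
  0 < alpha < 2 -> 0 <= a < b ->
  \int[@lebesgue_measure R]_t
    (trapezoid_kernel a b t * expR (- 2 * stable_exponent alpha t))
  <= 1 - 1 / (2 + alpha * b `^ alpha).
Proof.
move=> a02 ab; have /andP[a0 _] := a02.
have b0 : 0 < b by case/andP : ab; exact: le_lt_trans.
pose X n t := cos_transform (pareto alpha (cutoff alpha n)) t.
pose k := trapezoid_kernel a b.
have ik : (@lebesgue_measure R).-integrable setT (EFin \o k).
  exact: integrable_trapezoid_kernel.
have X1 n t : `|X n t| <= 1.
  apply: cos_transform_le1.
  - by move=> s; exact: pareto_ge0.
  - by apply: integrable_pareto => //; exact: cutoff_gt0.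
  - by apply: Rintegral_pareto => //; exact: cutoff_gt0.
have iX n : (@lebesgue_measure R).-integrable setT (EFin \o (fun t => k t * X n t ^+ n.+1)).
  apply: integrable_mul_cos_transformX => //.
  - by move=> s; exact: pareto_ge0.
  - by apply: integrable_pareto => //; exact: cutoff_gt0.
  - by apply: Rintegral_pareto => //; exact: cutoff_gt0.
have mf n : measurable_fun setT (fun t : R => (k t * X n t ^+ n.+1)%:E).
  exact: (measurable_int _ (iX n)).
have cvgf (t : R) : (k t * X n t ^+ n.+1)%:E @[n --> \oo] -->
    (k t * expR (- 2 * stable_exponent alpha t))%:E.
  apply: cvg_EFin; first by near=> n.
  by apply: cvgM; [exact: cvg_cst|exact: cos_transform_pareto_cvg].
have dom n (t : R) : (`|(k t * X n t ^+ n.+1)%:E| <= `|(k t)%:E|)%E.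
  by rewrite lee_fin normrM ler_piMr// normrX exprn_ile1.
have lim : \int[@lebesgue_measure R]_t (k t * X n t ^+ n.+1) @[n --> \oo] -->
    \int[@lebesgue_measure R]_t (k t * expR (- 2 * stable_exponent alpha t)).
  apply: fine_cvg.
  have mfl : measurable_fun [set: R]
      (fun t => (k t * expR (- 2 * stable_exponent alpha t))%:E).
    exact: (emeasurable_fun_cvg _ _ mf (fun t _ => cvgf t)).
  have [|||ifl _ dcvg] := @dominated_convergence _ _ _ (@lebesgue_measure R) _ measurableT
    (fun n t => (k t * X n t ^+ n.+1)%:E)
    (fun t => (k t * expR (- 2 * stable_exponent alpha t))%:E) (fun t => `|(k t)%:E|%E)
    mf mfl.
  - by apply: aeW => t _; exact: cvgf.
  - exact: (integrable_norm ik).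
  - by apply: aeW => t n _; exact: dom.
  by rewrite /Rintegral fineK; [exact: dcvg|exact: integrable_fin_num].
apply: (cvgr_to_le lim).
(* The bound on the iterates requires the cutoff to be at most [b], hence is available only
   eventually. *)
have [N hN] := cutoff_le_near a0 b0.
exists N => // n /hN cb /=.
have [_ /(_ 0)] := cos_transform_iterate n.+1 a0 (cutoff_gt0 n a0) cb ab.
rewrite {1}/cos_transform => h.
have {h} : \int[@lebesgue_measure R]_t (k t * X n t ^+ n.+1) <=
    2^-1 + (1 - cutoff alpha n `^ alpha * b `^ (- alpha)) ^+ n.+1 / 2.
  apply: le_trans h; rewrite le_eqVlt; apply/orP; left; apply/eqP.
  by apply: eq_Rintegral => t _; rewrite mulr0 cos0 mulr1.
move=> /le_trans; apply; rewrite cutoff_powR//.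
have nn0 : n.+1%:R != 0 :> R by rewrite pnatr_eq0.
set q := b `^ alpha.
have q0 : 0 < q by rewrite powR_gt0.
have -> : b `^ (- alpha) = q^-1 by rewrite powRN.
(* This is the Levy mass of [|x| >= b]; a single jump has size at least [b] with probability
   [l / (n + 1)]. *)
pose l := 2 / (alpha * q).
have l0 : 0 < l by rewrite divr_gt0// mulr_gt0.
have lE (M : R) : M != 0 -> 2 / (alpha * M) / q = l / M.
  by move=> M0; rewrite /l; field; rewrite M0 !gt_eqF.
have -> : 2 / (alpha * n.+1%:R) / q = l / n.+1%:R.
  exact: lE.
have p1 : l / n.+1%:R <= 1.
  have : cutoff alpha n `^ alpha <= q.
    by rewrite ge0_ler_powR ?nnegrE ?(ltW a0) ?(ltW b0)// ltW// cutoff_gt0.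
  rewrite cutoff_powR// => h; rewrite -(ler_pM2r q0) mul1r (le_trans _ h)//.
  by rewrite -(lE _ nn0) divfK ?gt_eqF.
(* Through [(1 - l / (n + 1))^(n + 1) <= exp (- l) <= 1 / (1 + l)]; the first step needs the
   nonnegative base given by [p1]. *)
have pw : (1 - l / n.+1%:R) ^+ n.+1 <= (1 + l)^-1.
  apply: (@le_trans _ _ (expR (- (l / n.+1%:R)) ^+ n.+1)).
    apply: lerXn2r; rewrite ?nnegrE ?expR_ge0 ?subr_ge0//.
    exact: expR_ge1Dx.
  rewrite -expRM_natl mulrN mulrC divfK ?pnatr_eq0// expRN.
  by rewrite lef_pV2 ?posrE ?expR_gt0 ?addr_gt0// expR_ge1Dx.
apply: (@le_trans _ _ (2^-1 + (1 + l)^-1 / 2)); first by rewrite lerD2l ler_pM2r.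
rewrite le_eqVlt; apply/orP; left; apply/eqP; rewrite /l; field.
by rewrite ?gt_eqF ?addr_gt0 ?mulr_gt0.
Unshelve. all: by end_near. Qed.

(** * Tail bounds *)

Lemma Rintegral_indicM {R : realType} (D : set R) (f : R -> R) :
  \int[@lebesgue_measure R]_t (\1_D t * f t) = \int[@lebesgue_measure R]_(t in D) f t.
Proof.
rewrite [RHS]Rintegral_mkcond; apply: eq_Rintegral => t _.
by rewrite patchE indicE; case: ifPn => _; rewrite ?mul1r ?mul0r.
Qed.

Lemma Rintegral_indic_itv {R : realType} (u : R) : 0 < u ->
  \int[@lebesgue_measure R]_t (\1_(`]0, u]) t : R) = u.
Proof.
move=> u0; rewrite /Rintegral integral_indic//= setIT lebesgue_measure_itv/=.
by rewrite lte_fin u0 oppr0 adde0.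
Qed.

Lemma Rintegral_cos_itv {R : realType} (u x : R) : 0 < u -> x != 0 ->
  \int[@lebesgue_measure R]_(t in `]0, u]) cos (t * x) = x^-1 * sin (x * u).
Proof.
move=> u0 x0.
have cc : continuous (fun t : R => cos (t * x)).
  by under eq_fun do rewrite mulrC; exact: continuous_cosM.
have cs : continuous (fun t : R => x^-1 * sin (x * t)).
  move=> t; apply: cvgM; first exact: cvg_cst.
  apply: (@continuous_comp _ _ _ (fun t => x * t)); last exact: continuous_sin.
  by apply: cvgM; [exact: cvg_cst|exact: cvg_id].
have dx (t : R) : derivable (fun t => x * t) t 1 by exact: derivableM.
have dsin (t : R) : derivable (fun t => sin (x * t)) t 1.
  apply/derivable1_diffP; apply: (@differentiable_comp _ _ _ _ (fun t => x * t) (@sin R)).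
    exact/derivable1_diffP.
  exact/derivable1_diffP/derivable_sin.
have ic : (@lebesgue_measure R).-integrable `[0, u] (EFin \o (fun t : R => cos (t * x))).
  apply: continuous_compact_integrable; first exact: segment_compact.
  exact: continuous_subspaceT.
rewrite Rintegral_itv_obnd_cbnd; last first.
  apply: integrableS ic => // t /=.
  by rewrite !in_itv/= => /andP[/ltW -> ->].
rewrite /Rintegral (@continuous_FTC2 _ _ (fun t => x^-1 * sin (x * t)))//.
- by rewrite mulr0 sin0 mulr0 sube0.
- exact: continuous_subspaceT.
- split.
  + by move=> t _; apply: derivableM.
  + by apply: cvg_at_right_filter; exact: cs.
  + by apply: cvg_at_left_filter; exact: cs.
- move=> t _; rewrite derive1E deriveMl// -derive1E.
  rewrite (@derive1_comp _ (fun t => x * t) (@sin R))// derive1_mull.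
  by rewrite /= derive1E derive_val mulrCA mulVf// mulr1 (mulrC x).
Qed.

(** Integrating [1 - cos (t x)] over [0 < t <= u] gives [u - sin (x u) / x]. It is nonnegative, and
    at least [u - 1 / y] when [|x| >= y]; the choice [u = 2 / y] makes this [1 / y]. *)
Lemma tail_le_Rintegral_charfun d (T : measurableType d) (R : realType)
    (P : probability T R) (W : T -> R) (phi : R -> R) (y : R) :
  measurable_fun setT W -> (forall t, \int[P]_w cos (t * W w) = phi t) -> 0 < y ->
  (@lebesgue_measure R).-integrable setT
    (EFin \o (fun t => \1_(`]0, (2 / y)]) t * phi t)) /\
  fine (P [set w | y <= `|W w|]) / y
    <= 2 / y - \int[@lebesgue_measure R]_t (\1_(`]0, (2 / y)]) t * phi t).
Proof.
move=> mW hcos y0; set u := 2 / y; set v : R -> R := \1_(`]0, u]).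
have u0 : 0 < u by rewrite divr_gt0.
have iv : (@lebesgue_measure R).-integrable setT (EFin \o v).
  exact: integrable_indic_itv.
have mh : measurable_fun [set: R * T] (fun z => cos (z.1 * W z.2)).
  apply: (@measurableT_comp _ _ _ _ _ _ (@cos R)); first exact: measurable_cos_real.
  by apply: measurable_funM => //; exact: measurableT_comp.
have mh' : measurable_fun [set: T * R] (fun z => cos (z.2 * W z.1)).
  apply: (@measurableT_comp _ _ _ _ _ _ (@cos R)); first exact: measurable_cos_real.
  by apply: measurable_funM => //; exact: measurableT_comp.
have i1 := finite_measure_integrable_cst P 1 measurableT.
have E1 t : \int[P]_w (cst 1 w * cos (t * W w)) = phi t.
  by rewrite -hcos; apply: eq_Rintegral => w _; rewrite mul1r.
(* Fubini is used in both orders: this one gives integrability in [t] and the exchange, the next one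
   integrability of the inner integral in [w]. *)
have [I1 E2] := @Rfubini_weighted _ _ _ _ _ (@lebesgue_measure R) P v (cst 1) _ iv i1 mh
  (fun z => cos_max _).
have [I2 _] := @Rfubini_weighted _ _ _ _ _ P (@lebesgue_measure R) (cst 1) v _ i1 iv mh'
  (fun z => cos_max _).
have {}I1 : (@lebesgue_measure R).-integrable setT (EFin \o (fun t => v t * phi t)).
  by apply: eq_integrable I1 => // t _ /=; rewrite E1.
split=> //.
have -> : \int[@lebesgue_measure R]_t (v t * phi t) =
    \int[P]_w (cst 1 w * \int[@lebesgue_measure R]_t (v t * cos (t * W w))).
  by rewrite -E2; apply: eq_Rintegral => t _; rewrite E1.
pose A := [set w | y <= `|W w|].
have mA : measurable A.
  by apply: measurable_set_ge; exact: measurableT_comp.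
have S1 x : \int[@lebesgue_measure R]_t (v t * cos (t * x)) <= u.
  rewrite -[leRHS](Rintegral_indic_itv u0); apply: le_Rintegral => //.
    apply: integrable_mul_bounded1 => // [|t]; last exact: cos_max.
    by under eq_fun do rewrite mulrC; exact: measurable_cosM.
  by move=> t _; rewrite ler_piMr ?cos_le1// /v indicE.
have S2 x : y <= `|x| -> \int[@lebesgue_measure R]_t (v t * cos (t * x)) <= u - y^-1.
  move=> yx; have x0 : 0 < `|x| by exact: lt_le_trans yx.
  rewrite Rintegral_indicM Rintegral_cos_itv -?normr_gt0//.
  have -> : u - y^-1 = y^-1 by rewrite /u; lra.
  rewrite (le_trans (ler_norm _))// normrM normfV.
  rewrite -[leRHS]mulr1 ler_pM ?invr_ge0 ?sin_max//.
  by rewrite lef_pV2 ?posrE.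
rewrite lerBrDr -lerBrDl.
have -> : u - fine (P A) / y = \int[P]_w (u - y^-1 * \1_A w).
  have iA : P.-integrable setT (EFin \o (fun w => \1_A w : R)) by exact: integrable_indic.
  rewrite RintegralB//; last 2 first.
  - exact: finite_measure_integrable_cst.
  - exact: integrable_EFinZl.
  have EA : \int[P]_w (\1_A w : R) = fine (P A).
    by rewrite /Rintegral integral_indic// setIT.
  have Eu : \int[P]_w u = u.
    rewrite Rintegral_cst// (_ : fine _ = 1) ?mulr1//.
    by rewrite -[RHS]/(fine 1%E); congr fine; exact: probability_setT.
  by rewrite Eu RintegralZl// EA mulrC.
apply: le_Rintegral => //.
  apply: integrable_EFinB => //; first exact: finite_measure_integrable_cst.
  by apply: integrable_EFinZl => //; exact: integrable_indic.
move=> w _; rewrite mul1r indicE; have [|_] := boolP (w \in A).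
  by rewrite inE/= mulr1 => /S2.
by rewrite mulr0 subr0.
Qed.

(** The inequality [1 - exp (- z) <= z] and the bound on the exponent give [1 - phi t <= D t^alpha],
    which is integrated over []0, 2 / y]]. *)
Lemma stable_tail_le d (T : measurableType d) (R : realType)
    (P : probability T R) (W : T -> R) (alpha y : R) :
  measurable_fun setT W -> 0 < alpha < 1 ->
  (forall t, \int[P]_w cos (t * W w) = expR (- 2 * stable_exponent alpha t)) -> 0 < y ->
  fine (P [set w | y <= `|W w|]) <= 8 / (alpha * y `^ alpha).
Proof.
move=> mW /andP[a0 a1] hcos y0.
have a02 : 0 < alpha < 2 by rewrite a0/=; lra.
have [Iphi] := tail_le_Rintegral_charfun mW hcos y0.
set u := 2 / y; set p := fine _; set v : R -> R := \1_(`]0, u]).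
have u0 : 0 < u by rewrite divr_gt0.
have iv : (@lebesgue_measure R).-integrable setT (EFin \o v).
  exact: integrable_indic_itv.
pose C := 4 / (alpha * (2 - alpha)).
have C0 : 0 < C by rewrite divr_gt0// mulr_gt0//; lra.
(* Twice the bound [(2 / t)^(- alpha) C] on the exponent equals [D t^alpha]. *)
pose D := 2 * C * 2 `^ (- alpha).
(* The exponent is spelled [alpha + 1 - 1] to match [integral_powR_head] at [b = alpha + 1]. *)
have it : (@lebesgue_measure R).-integrable `]0, u] (EFin \o (fun t => t `^ (alpha + 1 - 1))).
  apply/integrableP; split.
    by apply/measurable_EFinP/measurable_funTS; exact: measurable_powR.
  under eq_integral do rewrite gee0_abs ?lee_fin ?powR_ge0//.
  by rewrite integral_powR_head ?addr_gt0// ltry.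
have ivt : (@lebesgue_measure R).-integrable setT
    (EFin \o (fun t => v t * t `^ (alpha + 1 - 1))).
  have : (@lebesgue_measure R).-integrable setT
      ((EFin \o (fun t : R => t `^ (alpha + 1 - 1))) \_ `]0, u]).
    by apply: (iffLR (integrable_mkcond _ _)) => //; exact: it.
  apply: eq_integrable => // t _; rewrite patchE /= /v indicE.
  by case: ifPn => _; rewrite ?mul1r ?mul0r.
have lo : u - D * (u `^ (alpha + 1) / (alpha + 1)) <=
    \int[@lebesgue_measure R]_t (v t * expR (- 2 * stable_exponent alpha t)).
  have -> : u - D * (u `^ (alpha + 1) / (alpha + 1)) =
      \int[@lebesgue_measure R]_t (v t - D * (v t * t `^ (alpha + 1 - 1))).
    rewrite RintegralB//; last exact: integrable_EFinZl.
    rewrite RintegralZl// Rintegral_indic_itv// Rintegral_indicM.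
    by rewrite /Rintegral integral_powR_head ?addr_gt0.
  apply: le_Rintegral => //.
    by apply: integrable_EFinB => //; exact: integrable_EFinZl.
  move=> t _; rewrite /v indicE; have [|_] := boolP (t \in _); last by rewrite !mul0r mulr0 subr0.
  rewrite inE/= in_itv/= => /andP[t0 _]; rewrite !mul1r addrK.
  apply: le_trans (expR_ge1Dx _); rewrite lerD2l mulNr lerN2 /D -2!mulrA ler_pM2l//.
  rewrite (le_trans (stable_exponent_le a02 t0))// -/C [_ * C]mulrC ler_pM2l//.
  rewrite powRM ?invr_ge0 ?(ltW t0)// ler_wpM2l ?powR_ge0//.
  by rewrite -[t^-1]powR_inv1 ?(ltW t0)// -powRrM mulN1r opprK.
move=> h.
have {h} : p / y <= D * (u `^ (alpha + 1) / (alpha + 1)).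
  by apply: (le_trans h); lra.
have q0 : 0 < y `^ alpha by rewrite powR_gt0.
have -> : u `^ (alpha + 1) = 2 `^ alpha * (y `^ alpha)^-1 * (2 / y).
  rewrite powRD; last by rewrite (gt_eqF u0) implybT.
  rewrite powRr1 ?(ltW u0)// powRM ?invr_ge0 ?(ltW y0)//.
  by rewrite -[y^-1 in LHS]powR_inv1 ?(ltW y0)// -powRrM mulN1r powRN.
have -> : D = 2 * C * (2 `^ alpha)^-1 by rewrite /D powRN.
have t0 : 0 < 2 `^ alpha :> R by rewrite powR_gt0.
rewrite ler_pdivrMr// => h; apply: (le_trans h).
have -> : 2 * C / 2 `^ alpha * (2 `^ alpha / y `^ alpha * (2 / y) / (alpha + 1)) * y
    = (8 / (alpha * y `^ alpha)) * (2 / ((2 - alpha) * (alpha + 1))).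
  rewrite /C; field.
  by rewrite !gt_eqF//; lra.
(* The remaining factor is at most [1] because [(2 - alpha)(alpha + 1) = 2 + alpha (1 - alpha)] and
   [alpha < 1]. *)
rewrite ler_piMr ?divr_ge0 ?mulr_ge0 ?(ltW a0) ?(ltW q0)//.
have pos : 0 < (2 - alpha) * (alpha + 1) by rewrite mulr_gt0//; lra.
by rewrite ler_pdivrMr// mul1r; nra.
Qed.

Lemma stable_tail_ge d (T : measurableType d) (R : realType)
    (P : probability T R) (W : T -> R) (alpha a b : R) :
  measurable_fun setT W -> 0 < alpha < 2 ->
  (forall t, \int[P]_w cos (t * W w) = expR (- 2 * stable_exponent alpha t)) ->
  (forall t, \int[P]_w sin (t * W w) = 0) -> 0 <= a < b ->
  ((1 / (2 + alpha * b `^ alpha))%:E <= P [set w | a < `|W w|]%R)%E.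
Proof.
move=> mW a02 hcos hsin ab.
have mN : measurable_fun setT (fun w => `|W w|) by exact: measurableT_comp.
have mA : measurable [set w | `|W w| <= a] by exact: measurable_set_le.
have -> : [set w | a < `|W w|] = ~` [set w | `|W w| <= a].
  by apply/seteqP; split => w /=; rewrite ltNge => /negP.
rewrite probability_setC//.
have := trapezoid_ge_probability P 0 mW ab.
rewrite (expectation_trapezoid _ mW hcos hsin); last by case/andP : ab.
under eq_set do rewrite subr0.
under eq_Rintegral do rewrite mulr0 cos0 mul1r.
have := stable_trapezoid_le a02 ab; rewrite -lee_fin => h1 h2.
have := le_trans h2 h1 => h3.
rewrite leeBrDr; last by rewrite fin_num_measure.
apply: (le_trans (leeD (lexx _) h3)).
by rewrite -EFinD lee_fin; lra.
Qed.

Theorem theorem7 (d : measure_display) (T : measurableType d) (R : realType)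
  (P : probability T R) (X : {RV P >-> R}) (alpha : R) :
  0 < alpha < 2 -> alpha != 1 ->
  (forall t : R,
     charfun P X t = ((expR (- 2 * stable_exponent alpha t))%:C)%C) ->
  (forall y : R, 0 < y ->
     ((1 / 2 * (1 / (2 + alpha * y `^ alpha)))%:E <= P [set w | (y <= X w)%R])%E) /\
  (alpha < 1 -> forall y : R, 0 < y ->
     (P [set w | (y <= X w)%R] <= (4 / (alpha * y `^ alpha))%:E)%E).
Proof.
move=> a02 _ hX; have /andP[a0 a2] := a02.
have hcos t : \int[P]_w cos (t * X w) = expR (- 2 * stable_exponent alpha t).
  by have [] := hX t.
have hsin t : \int[P]_w sin (t * X w) = 0 by have [] := hX t.
have mX : measurable_fun setT X by exact: measurable_funPT.
have mY : measurable_fun setT (fun w => - X w) by exact: measurable_funN.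
have ncos t : \int[P]_w cos (t * - X w) = expR (- 2 * stable_exponent alpha t).
  by rewrite -hcos; apply: eq_Rintegral => w _; rewrite mulrN cosN.
have nsin t : \int[P]_w sin (t * - X w) = 0.
  transitivity (\int[P]_w (-1 * sin (t * X w))).
    by apply: eq_Rintegral => w _; rewrite mulrN sinN mulN1r.
  rewrite RintegralZl ?hsin ?mulr0//.
  apply: integrable_bounded1 => [|w]; last exact: sin_max.
  exact: (measurableT_comp (measurable_sinM t)).
have mge z : measurable [set w | z <= X w] by exact: measurable_set_ge.
have mgeN z : measurable [set w | z <= - X w] by exact: measurable_set_ge.
have Pfin z : P [set w | z <= X w] = (fine (P [set w | z <= X w]))%:E.
  by rewrite fineK// fin_num_measure.
(* The comparison of tails loses an arbitrarily small shift of the level. Continuity of the bounds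
   in [y] removes it, with [c = 2] for the lower bound and [c = 0] for the upper one. *)
have continuous_bound (k c y : R) : 0 < y -> 0 <= c -> c + alpha * y `^ alpha != 0 ->
    k / (c + alpha * z `^ alpha) @[z --> y] --> k / (c + alpha * y `^ alpha).
  move=> y0 c0 cy; apply: cvgM; first exact: cvg_cst.
  apply: cvgV => //; apply: cvgD; first exact: cvg_cst.
  by apply: cvgM; [exact: cvg_cst|exact: continuous_powR].
split=> [y y0|a1 y y0].
  have q0 (z : R) : 0 < 2 + alpha * z `^ alpha.
    by rewrite ltr_wpDr// mulr_ge0 ?powR_ge0// ltW.
  rewrite Pfin lee_fin -mulrA mul1r -[leLHS]mulrC.
  have lim := cvg_at_right_filter (continuous_bound 1 2 y y0 (ler0n _ _) (lt0r_neq0 (q0 y))).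
  rewrite ler_pdivrMr// (cvgr_to_le lim)//; near=> b.
  have yb : y < b by [].
  (* The level [a] must exceed [y] for the tail comparison and stay below [b] for the trapezoid. *)
  pose a := (y + b) / 2.
  have ya : y < a by rewrite /a; lra.
  have ab : 0 <= a < b by rewrite /a; apply/andP; split; lra.
  rewrite -lee_fin (le_trans (stable_tail_ge mX a02 hcos hsin ab))//.
  apply: (@le_trans _ _ (P ([set w | a <= X w] `|` [set w | a <= - X w]))).
    rewrite le_measure ?inE//.
    - rewrite (_ : [set w | a < `|X w|] = ~` [set w | `|X w| <= a]).
        by apply: measurableC; apply: measurable_set_le; exact: measurableT_comp.
      by apply/seteqP; split => w /=; rewrite ltNge => /negP.
    - exact: measurableU.
    - by move=> w /= /ltW; rewrite ler_normr => /orP[]; [left|right].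
  apply: (le_trans (measureU2 _ _ _)) => //.
  (* Each of the tails of [X] and [-X] at level [a] is at most the tail of [X] at [y], which
     accounts for the factor [1/2]. *)
  rewrite mulr_natr mulr2n EFinD -Pfin; apply: leeD.
    exact: (tail_le_of_same_charfun mX mX hcos hsin hcos hsin ya).
  exact: (tail_le_of_same_charfun mY mX ncos nsin hcos hsin ya).
have q0 (z : R) : 0 < z -> 0 < 0 + alpha * z `^ alpha.
  by move=> z0; rewrite add0r mulr_gt0// powR_gt0.
rewrite Pfin lee_fin.
have lim := cvg_at_left_filter (continuous_bound 4 0 y y0 (lexx _) (lt0r_neq0 (q0 _ y0))).
rewrite -[alpha * _]add0r (cvgr_to_ge lim)//; near=> z.
have zy : z < y by [].
have z0 : 0 < z by near: z; exact: nbhs_left_gt.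
have a01 : 0 < alpha < 1 by rewrite a0.
have g1 := stable_tail_le mX a01 hcos z0.
have h1 := tail_le_of_same_charfun mX mX hcos hsin hcos hsin zy.
have h2 := tail_le_of_same_charfun mX mY hcos hsin ncos nsin zy.
(* Two copies of the tail at [y] fit into the disjoint events [z <= X] and [z <= - X], so the
   two-sided constant [8] becomes [4]. *)
have : (P [set w | (y <= X w)%R] + P [set w | (y <= X w)%R]
    <= P [set w | (z <= `|X w|)%R])%E.
  apply: (le_trans (leeD h1 h2)); rewrite -measureU//; last first.
    by apply/seteqP; split => // w /= [w1 w2]; lra.
  rewrite (_ : _ `|` _ = [set w | z <= `|X w|])//.
  by apply/seteqP; split => w /=; rewrite ler_normr => /orP.
have -> : P [set w | z <= `|X w|] = (fine (P [set w | z <= `|X w|]))%:E.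
  rewrite fineK// fin_num_measure//.
  by apply: measurable_set_ge; exact: measurableT_comp.
rewrite [in X in X -> _]Pfin -EFinD lee_fin add0r => g2.
have : 8 / (alpha * z `^ alpha) = 2 * (4 / (alpha * z `^ alpha)).
  by rewrite mulrA; congr (_ / _); ring.
by move: (4 / _) g1 => q g1 qE; rewrite qE in g1; lra.
Unshelve. all: by end_near. Qed.
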